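(* Let $L$ be a finite-dimensional Lie algebra over a field $\mathbb{F}$ of prime characteristic. If $L$ is not solvable, then there exists an irreducible $L$-module $S$ such that $H^1(L/\operatorname{Ann}_L(S),S)\neq 0$.
   Context: $H^n(L,M)$ denotes the ordinary (Chevalley–Eilenberg) cohomology of a Lie algebra $L$ with coefficients in an $L$-module $M$. $\operatorname{Ann}_L(S):=\{x\in L\mid x\cdot s=0 \text{ for all } s\in S\}$, and $S$ is regarded as an $L/\operatorname{Ann}_L(S)$-module in the natural way. *)

(* Defs.v *)
From HB Require Import structures.
From mathcomp Require Import all_boot all_order all_algebra.
From mathcomp Require Import ring_quotient boolp classical_sets functions.

Set Implicit Arguments.
Unset Strict Implicit.
Unset Printing Implicit Defensive.

Import GRing.Theory.
Local Open Scope quotient_scope.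
Local Open Scope ring_scope.

HB.mixin Record Lmodule_isLieAlgebra (F : fieldType) L
    of GRing.Lmodule F L := {
  lie : L -> L -> L;
  lie_linearl : forall z, linear (lie^~ z);
  lie_linearr : forall z, linear (lie z);
  liexx : forall x, lie x x = 0;
  lie_jacobi : forall x y z,
    lie x (lie y z) + lie y (lie z x) + lie z (lie x y) = 0
}.

#[short(type="lieAlgType")]
HB.structure Definition LieAlgebra (F : fieldType) :=
  {L of GRing.Lmodule F L & Lmodule_isLieAlgebra F L}.

#[short(type="finDimLieAlgType")]
HB.structure Definition FinDimLieAlgebra (F : fieldType) :=
  {L of Vector F L & LieAlgebra F L}.

Section LieTheory.
Variables (F : fieldType) (L : lieAlgType F).

Lemma lieDl (x y z : L) : lie (x + y) z = lie x z + lie y z.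
Proof. by have := lie_linearl z 1 x y; rewrite !scale1r. Qed.
Lemma lieDr (x y z : L) : lie z (x + y) = lie z x + lie z y.
Proof. by have := lie_linearr z 1 x y; rewrite !scale1r. Qed.
Lemma lie0l (z : L) : lie 0 z = 0.
Proof. by apply: (addrI (lie 0 z)); rewrite -lieDl !addr0. Qed.
Lemma lie0r (z : L) : lie z 0 = 0.
Proof. by apply: (addrI (lie z 0)); rewrite -lieDr !addr0. Qed.
Lemma lieNl (x z : L) : lie (- x) z = - lie x z.
Proof. by apply/eqP; rewrite -addr_eq0 -lieDl addNr lie0l. Qed.
Lemma lieNr (x z : L) : lie z (- x) = - lie z x.
Proof. by apply/eqP; rewrite -addr_eq0 -lieDr addNr lie0r. Qed.
Lemma lieBl (x y z : L) : lie (x - y) z = lie x z - lie y z.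
Proof. by rewrite lieDl lieNl. Qed.
Lemma lieBr (x y z : L) : lie z (x - y) = lie z x - lie z y.
Proof. by rewrite lieDr lieNr. Qed.
Lemma lieZl a (x z : L) : lie (a *: x) z = a *: lie x z.
Proof. by have := lie_linearl z a x 0; rewrite !addr0 lie0l addr0. Qed.
Lemma lieZr a (x z : L) : lie z (a *: x) = a *: lie z x.
Proof. by have := lie_linearr z a x 0; rewrite !addr0 lie0r addr0. Qed.
Lemma lieC (x y : L) : lie x y = - lie y x.
Proof.
apply/eqP; rewrite -addr_eq0; apply/eqP.
by have := liexx (x + y); rewrite lieDl !lieDr !liexx add0r addr0.
Qed.

End LieTheory.

Section Solvable.
Variables (F : fieldType) (L : finDimLieAlgType F).
Implicit Types U V W : {vspace L}.

Definition lie_prodv U V : {vspace L} :=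
  <<[seq lie x y | x <- vbasis U, y <- vbasis V]>>%VS.

(* [lie_prodv U V] does not depend on the chosen bases: it is the span of all
   brackets of an element of U with an element of V. *)
Lemma lie_prodv_subP U V W :
  (forall x y, x \in U -> y \in V -> lie x y \in W)
    <-> (lie_prodv U V <= W)%VS.
Proof.
split=> [sUVW|/span_subvP sUVW x y xU yV].
  apply/span_subvP=> _ /allpairsP[[x y] /= [xU yV ->]].
  by apply: sUVW; apply: vbasis_mem.
rewrite (coord_vbasis xU) (coord_vbasis yV).
have sumW (f : 'I_(\dim U) -> L) v : (forall i, lie (f i) v \in W) ->
    lie (\sum_i f i) v \in W.
  move=> fW; elim/big_rec: _ => [|i w _ wW]; first by rewrite lie0l mem0v.
  by rewrite lieDl memvD.
apply: (sumW) => i; rewrite lieZl memvZ //.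
elim/big_rec: _ => [|j w _ wW]; first by rewrite lie0r mem0v.
rewrite lieDr memvD // lieZr memvZ //; apply: sUVW; apply/allpairsP.
by exists ((vbasis U)`_i, (vbasis V)`_j); rewrite !mem_nth ?size_tuple.
Qed.

Definition derived_series k : {vspace L} :=
  iter k (fun U => lie_prodv U U) fullv.

Definition lie_solvable : Prop := exists k, derived_series k = 0%VS.

End Solvable.
Arguments lie_solvable {F} L.

Record lmod_subspace (F : fieldType) (V : lmodType F) := LmodSubspace {
  lmod_subspace_pred :> {pred V};
  lmod_subspaceP : submod_closed lmod_subspace_pred
}.
HB.instance Definition _ (F : fieldType) (V : lmodType F) (I : lmod_subspace V) :=
  GRing.isSubmodClosed.Build F V (lmod_subspace_pred I) (lmod_subspaceP I).

Section LmodQuotient.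
Variables (F : fieldType) (V : lmodType F) (I : lmod_subspace V).

Definition lmod_quot : Type := Quotient.quot I.
HB.instance Definition _ := GRing.Zmodule.on lmod_quot.
HB.instance Definition _ : EqQuotient V (Quotient.equiv I) lmod_quot :=
  EqQuotient.on lmod_quot.

Implicit Types q : lmod_quot.

Lemma lmod_quotW (P : lmod_quot -> Prop) :
  (forall x, P (\pi_lmod_quot x)) -> forall q, P q.
Proof. by move=> Px q; rewrite -[q]reprK; apply: Px. Qed.

Lemma lmod_quot_eq (x y : V) : (x - y \in I) = (x == y %[mod lmod_quot]).
Proof. exact: Quotient.idealrBE. Qed.

Lemma pi_lmod_quotD (x y : V) :
  \pi_lmod_quot (x + y) = \pi_lmod_quot x + \pi_lmod_quot y.
Proof. exact: (@pi_addr _ _ _ _ _ (Quotient.quot I)). Qed.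

Lemma lmod_quot_eq0 (x : V) : (\pi_lmod_quot x == 0) = (x \in I).
Proof.
have -> : 0 = \pi_lmod_quot 0 :> lmod_quot.
  exact/esym/(@pi_zeror _ _ _ _ _ (Quotient.quot I)).
by rewrite -lmod_quot_eq subr0.
Qed.

Definition lmod_quot_scale (a : F) q : lmod_quot :=
  \pi_lmod_quot (a *: repr q).

Lemma pi_lmod_quot_scale a (x : V) :
  lmod_quot_scale a (\pi_lmod_quot x) = \pi_lmod_quot (a *: x).
Proof.
apply/eqP; rewrite /lmod_quot_scale -lmod_quot_eq -scalerBr rpredZ //.
by rewrite lmod_quot_eq reprK.
Qed.

Lemma lmod_quot_scaleA a b q :
  lmod_quot_scale a (lmod_quot_scale b q) = lmod_quot_scale (a * b) q.
Proof. by elim/lmod_quotW: q => x; rewrite !pi_lmod_quot_scale scalerA. Qed.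

Lemma lmod_quot_scale1 : left_id 1 lmod_quot_scale.
Proof. by elim/lmod_quotW=> x; rewrite pi_lmod_quot_scale scale1r. Qed.

Lemma lmod_quot_scaleDr : right_distributive lmod_quot_scale +%R.
Proof.
move=> a; elim/lmod_quotW=> x; elim/lmod_quotW=> y.
by rewrite -pi_lmod_quotD !pi_lmod_quot_scale scalerDr pi_lmod_quotD.
Qed.

Lemma lmod_quot_scaleDl q :
  {morph lmod_quot_scale^~ q : a b / a + b}.
Proof.
elim/lmod_quotW: q => x a b /=.
by rewrite !pi_lmod_quot_scale scalerDl pi_lmod_quotD.
Qed.

HB.instance Definition _ := GRing.Zmodule_isLmodule.Build F lmod_quot
  lmod_quot_scaleA lmod_quot_scale1 lmod_quot_scaleDr lmod_quot_scaleDl.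

Lemma pi_lmod_quotZ a (x : V) :
  \pi_lmod_quot (a *: x) = a *: \pi_lmod_quot x.
Proof. by rewrite -pi_lmod_quot_scale. Qed.

End LmodQuotient.

Record lieIdeal (F : fieldType) (L : lieAlgType F) := LieIdeal {
  ideal_subspace :> lmod_subspace L;
  lie_idealP : forall x y, y \in ideal_subspace -> lie x y \in ideal_subspace
}.

Section LieQuotient.
Variables (F : fieldType) (L : lieAlgType F) (I : lieIdeal L).

Definition lie_quot : Type := lmod_quot I.
HB.instance Definition _ := GRing.Lmodule.on lie_quot.
HB.instance Definition _ := EqQuotient.on lie_quot.

Implicit Types p q r : lie_quot.

Definition lie_quot_bracket p q : lie_quot :=
  \pi_lie_quot (lie (repr p) (repr q)).

Lemma lie_quotW (P : lie_quot -> Prop) :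
  (forall x, P (\pi_lie_quot x)) -> forall q, P q.
Proof. exact: lmod_quotW. Qed.

Lemma lie_quot_eq (x y : L) : (x - y \in I) = (x == y %[mod lie_quot]).
Proof. exact: lmod_quot_eq. Qed.

Lemma pi_lie_quotP a (x y : L) :
  \pi_lie_quot (a *: x + y) = a *: \pi_lie_quot x + \pi_lie_quot y.
Proof. by have := pi_lmod_quotD I (a *: x) y; rewrite pi_lmod_quotZ. Qed.

Lemma pi_lie_quotD (x y : L) :
  \pi_lie_quot (x + y) = \pi_lie_quot x + \pi_lie_quot y.
Proof. exact: pi_lmod_quotD. Qed.

Lemma pi_lie_quot0 : \pi_lie_quot 0 = 0.
Proof. by apply: (addrI (\pi_lie_quot 0)); rewrite -pi_lie_quotD !addr0. Qed.

Lemma pi_lie_quot_bracket (x y : L) :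
  lie_quot_bracket (\pi_lie_quot x) (\pi_lie_quot y) = \pi_lie_quot (lie x y).
Proof.
have reprI (z : L) : repr (\pi_lie_quot z) - z \in I.
  by rewrite lie_quot_eq reprK.
apply/eqP; rewrite -lie_quot_eq.
set x' := repr _; set y' := repr _.
have -> : lie x' y' - lie x y = lie x' (y' - y) - lie y (x' - x).
  rewrite !lieBr (lieC y x') (lieC y x) opprB opprK.
  by rewrite [X in _ = _ + X]addrC addrA subrK.
by rewrite rpredB ?lie_idealP ?reprI.
Qed.

Fact lie_quot_linearl r : linear (lie_quot_bracket^~ r).
Proof.
elim/lie_quotW: r => z a; elim/lie_quotW=> x; elim/lie_quotW=> y.
by rewrite -pi_lie_quotP !pi_lie_quot_bracket lie_linearl pi_lie_quotP.
Qed.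

Fact lie_quot_linearr r : linear (lie_quot_bracket r).
Proof.
elim/lie_quotW: r => z a; elim/lie_quotW=> x; elim/lie_quotW=> y.
by rewrite -pi_lie_quotP !pi_lie_quot_bracket lie_linearr pi_lie_quotP.
Qed.

Fact lie_quotxx p : lie_quot_bracket p p = 0.
Proof.
by elim/lie_quotW: p => x; rewrite pi_lie_quot_bracket liexx pi_lie_quot0.
Qed.

Fact lie_quot_jacobi p q r :
  lie_quot_bracket p (lie_quot_bracket q r)
  + lie_quot_bracket q (lie_quot_bracket r p)
  + lie_quot_bracket r (lie_quot_bracket p q) = 0.
Proof.
elim/lie_quotW: p => x; elim/lie_quotW: q => y; elim/lie_quotW: r => z.
by rewrite !pi_lie_quot_bracket -!pi_lie_quotD lie_jacobi pi_lie_quot0.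
Qed.

HB.instance Definition _ := Lmodule_isLieAlgebra.Build F lie_quot
  lie_quot_linearl lie_quot_linearr lie_quotxx lie_quot_jacobi.

End LieQuotient.

Record lie_action (F : fieldType) (L : lieAlgType F) (M : lmodType F) :=
    LieAction {
  lie_act :> L -> M -> M;
  lie_act_linearl : forall m, linear (lie_act^~ m);
  lie_act_linearr : forall x, linear (lie_act x);
  lie_act_lie : forall x y m,
    lie_act (lie x y) m = lie_act x (lie_act y m) - lie_act y (lie_act x m)
}.

Section Modules.
Variables (F : fieldType) (L : lieAlgType F) (M : lmodType F).
Variable rho : lie_action L M.

Lemma lie_act0r x : rho x 0 = 0.
Proof.
have := lie_act_linearr rho x 1 0 0; rewrite !scale1r addr0 => e.
by apply: (addrI (rho x 0)); rewrite -e addr0.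
Qed.

Definition is_submodule (W : set M) : Prop :=
  [/\ W 0,
      forall a u v, W u -> W v -> W (a *: u + v)
    & forall x u, W u -> W (rho x u)].

Definition lie_irreducible : Prop :=
  (exists m : M, m != 0) /\
  forall W : set M, is_submodule W -> W = [set 0]%classic \/ W = setT.

Definition ann_pred : {pred L} := fun x => `[< forall m, rho x m = 0 >].

Lemma ann_predP x : reflect (forall m, rho x m = 0) (x \in ann_pred).
Proof. exact: asboolP. Qed.

Fact ann_submod_closed : submod_closed ann_pred.
Proof.
split=> [|a x y /ann_predP x0 /ann_predP y0]; apply/ann_predP=> m.
  have := lie_act_linearl rho m 1 0 0; rewrite !scale1r addr0 => e.
  by apply: (addrI (rho 0 m)); rewrite -e addr0.
by have := lie_act_linearl rho m a x y => /= ->; rewrite x0 y0 scaler0 addr0.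
Qed.

Fact ann_ideal x y : y \in ann_pred -> lie x y \in ann_pred.
Proof.
move=> /ann_predP y0; apply/ann_predP=> m.
by rewrite lie_act_lie !y0 lie_act0r subrr.
Qed.

Definition lie_ann : lieIdeal L :=
  @LieIdeal F L (LmodSubspace ann_submod_closed) ann_ideal.

Definition ann_quot_act (q : lie_quot lie_ann) (m : M) : M := rho (repr q) m.

Lemma pi_ann_quot_act x m : ann_quot_act (\pi_(lie_quot lie_ann) x) m = rho x m.
Proof.
rewrite /ann_quot_act; set x' := repr _.
have /ann_predP x'x : x' - x \in lie_ann.
  by rewrite (lie_quot_eq lie_ann) reprK.
have := lie_act_linearl rho m 1 (x' - x) x => /=.
by rewrite !scale1r subrK x'x add0r.
Qed.

Fact ann_quot_linearl m : linear (ann_quot_act^~ m).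
Proof.
move=> a; elim/lie_quotW=> x; elim/lie_quotW=> y.
by rewrite -pi_lie_quotP !pi_ann_quot_act; apply: lie_act_linearl.
Qed.

Fact ann_quot_linearr q : linear (ann_quot_act q).
Proof. exact: lie_act_linearr. Qed.

Fact ann_quot_lie p q m :
  ann_quot_act (lie p q) m
  = ann_quot_act p (ann_quot_act q m) - ann_quot_act q (ann_quot_act p m).
Proof.
elim/lie_quotW: p => x; elim/lie_quotW: q => y.
have -> : lie (\pi_(lie_quot lie_ann) x) (\pi_(lie_quot lie_ann) y)
    = \pi_(lie_quot lie_ann) (lie x y) by apply: pi_lie_quot_bracket.
by rewrite !pi_ann_quot_act lie_act_lie.
Qed.

Definition ann_quot_action : lie_action (lie_quot lie_ann) M :=
  LieAction ann_quot_linearl ann_quot_linearr ann_quot_lie.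

End Modules.

Section ChevalleyEilenberg.
Variables (F : fieldType) (L : lieAlgType F) (M : lmodType F).
Variable rho : lie_action L M.

Definition ce_fun n : Type := {ffun 'I_n -> L} -> M.
HB.instance Definition _ n := GRing.Lmodule.on (ce_fun n).

Definition set_arg n (x : {ffun 'I_n -> L}) (i : 'I_n) (y : L) :
    {ffun 'I_n -> L} :=
  [ffun k => if k == i then y else x k].

Definition is_cochain n (f : ce_fun n) : Prop :=
  (forall x i, linear (fun y => f (set_arg x i y))) /\
  (forall (x : {ffun 'I_n -> L}) i j, i != j -> x i = x j -> f x = 0).

(* (x_0, .., ^x_i, .., x_n) *)
Definition omit1 n (x : {ffun 'I_n.+1 -> L}) (i : 'I_n.+1) : {ffun 'I_n -> L} :=
  [ffun k : 'I_n => x (lift i k)].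

(* ([x_i, x_j], x_0, .., ^x_i, .., ^x_j, .., x_n), for i < j: the k-th entry
   of the list with x_i and x_j removed has index bump j (bump i k). *)
Definition omit2 n (x : {ffun 'I_n.+1 -> L}) (i j : 'I_n.+1) :
    {ffun 'I_n -> L} :=
  [ffun k : 'I_n => if val k is k'.+1 then x (inord (bump j (bump i k')))
                    else lie (x i) (x j)].

Definition ce_d n (f : ce_fun n) : ce_fun n.+1 := fun x =>
  \sum_(i < n.+1) (-1) ^+ i *: rho (x i) (f (omit1 x i))
  + \sum_(i < n.+1) \sum_(j < n.+1 | (i < j)%N)
      (-1) ^+ (i + j) *: f (omit2 x i j).

Definition is_cocycle n (f : ce_fun n) : Prop := is_cochain f /\ ce_d f = 0.

Definition is_coboundary n : ce_fun n -> Prop :=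
  if n is m.+1 then fun f => exists2 g : ce_fun m, is_cochain g & f = ce_d g
  else fun f => f = 0.

Lemma ce_funE n a (f g : ce_fun n) x : (a *: f + g) x = a *: f x + g x.
Proof. by []. Qed.

Lemma is_cochainP n a (f g : ce_fun n) :
  is_cochain f -> is_cochain g -> is_cochain (a *: f + g).
Proof.
move=> [fl fa] [gl ga]; split=> [x i b y z|x i j ij xij].
  have /= fE := fl x i b y z; have /= gE := gl x i b y z.
  rewrite !ce_funE fE gE !scalerDr !scalerA mulrC -!addrA; congr (_ + _).
  by rewrite addrCA.
by rewrite ce_funE (fa x i j ij xij) (ga x i j ij xij) scaler0 addr0.
Qed.

Lemma is_cochain0 n : is_cochain (0 : ce_fun n).
Proof. by split=> // x i a y z /=; rewrite scaler0 addr0. Qed.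

Lemma ce_dP n a (f g : ce_fun n) : ce_d (a *: f + g) = a *: ce_d f + ce_d g.
Proof.
apply/funext => x; rewrite ce_funE /ce_d scalerDr addrACA !scaler_sumr.
congr (_ + _); rewrite -big_split /=; apply: eq_bigr => i _.
  have := lie_act_linearr rho (x i) a (f (omit1 x i)) (g (omit1 x i)).
  by rewrite ce_funE => ->; rewrite scalerDr !scalerA mulrC.
rewrite scaler_sumr -big_split /=; apply: eq_bigr => j _.
by rewrite ce_funE scalerDr !scalerA mulrC.
Qed.

Lemma ce_d0 n : ce_d (0 : ce_fun n) = 0.
Proof.
by have := ce_dP (-1) (0 : ce_fun n) 0; rewrite !scaleN1r !addNr.
Qed.

Definition cocycles n : {pred ce_fun n} := fun f => `[< is_cocycle f >].

Fact cocycles_submod_closed n : submod_closed (@cocycles n).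
Proof.
split=> [|a f g /asboolP[fc f0] /asboolP[gc g0]]; apply/asboolP.
  by split; [apply: is_cochain0|apply: ce_d0].
by split; [apply: is_cochainP|rewrite ce_dP f0 g0 scaler0 addr0].
Qed.

HB.instance Definition _ n := GRing.isSubmodClosed.Build F (ce_fun n)
  (@cocycles n) (@cocycles_submod_closed n).

Definition ce_Z n : Type := {f : ce_fun n | f \in @cocycles n}.
HB.instance Definition _ n := [isSub of ce_Z n for sval].
HB.instance Definition _ n := [Choice of ce_Z n by <:].
HB.instance Definition _ n := [SubChoice_isSubLmodule of ce_Z n by <:].

(* Coboundaries are taken inside Z^n; nothing is lost since d \o d = 0. *)
Definition coboundaries n : {pred ce_Z n} := fun z => `[< is_coboundary (val z) >].

Fact coboundaries_submod_closed n : submod_closed (@coboundaries n).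
Proof.
split=> [|a y z /asboolP yB /asboolP zB]; apply/asboolP.
  rewrite raddf0; case: n => [|n] //=.
  by exists 0; [apply: is_cochain0|rewrite ce_d0].
have -> : val (a *: y + z) = a *: val y + val z by [].
case: n y z yB zB => [|n] y z /=; first by move=> -> ->; rewrite scaler0 addr0.
move=> [f fc ->] [g gc ->]; exists (a *: f + g); first exact: is_cochainP.
by rewrite ce_dP.
Qed.

Definition ce_B n : lmod_subspace (ce_Z n) :=
  LmodSubspace (@coboundaries_submod_closed n).

Definition ce_H n : lmodType F := lmod_quot (ce_B n).

Lemma ce_H_neq0P n :
  (exists h : ce_H n, h != 0)
    <-> exists f : ce_fun n, is_cocycle f /\ ~ is_coboundary f.
Proof.
split=> [[h]|[f [fZ fB]]].
  elim/lmod_quotW: h => z; rewrite lmod_quot_eq0 => zB; exists (val z).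
  split; first exact/asboolP/(valP z).
  by move=> bz; case/negP: zB; apply/asboolP.
have fz : f \in @cocycles n by apply/asboolP.
exists (\pi_(lmod_quot (ce_B n)) (exist _ f fz)).
by rewrite lmod_quot_eq0; apply/negP => /asboolP.
Qed.

End ChevalleyEilenberg.

(* Main.v *)
Require Import Defs.
From HB Require Import structures.
From mathcomp Require Import all_boot all_order all_algebra all_field.
From mathcomp Require Import generic_quotient.
From mathcomp Require Import mpoly.
From mathcomp Require Import boolp classical_sets.
Set Implicit Arguments.
Unset Strict Implicit.
Unset Printing Implicit Defensive.
Import GRing.Theory passmx.
Local Open Scope quotient_scope.
Local Open Scope classical_set_scope.
Local Open Scope ring_scope.

(** Let [D] be the last term of the derived series of [L], a nonzero ideal with
    [D = [D, D]], and let [R] be maximal among the ideals that do not contain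
    [D].  An irreducible module on which [R] acts as zero but [D] does not has
    annihilator exactly [R], by maximality; so it is enough to find one such
    module [S] with nonzero first cohomology over [L / R].

    Suppose that there is none ([h1_vanishes]).  Then the trivial and the
    nontrivial part of the action of [D] separate in every finite-dimensional
    [L / R]-module: if [D] maps [V] into a submodule [N], then [V = N + V^D]
    ([trivial_complement]).  Dividing out irreducible pieces of [N] one by one
    reduces this to an extension of a [D]-trivial module [T] by an irreducible
    [S].  If [D] kills [S], then [D = [D, D]] kills the extension.  Otherwise
    the obstruction to splitting it lies in [H^1(L / R, Hom(T, S))].  All
    [D]-composition factors of [S] are isomorphic and nontrivial
    ([irreducible_trivial_free]), so those of [Hom(T, S)] are nontrivial too,
    and [H^1] vanishes by induction along a composition series
    ([h1_trivial_free]).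

    In characteristic [p] this is contradicted by the symmetric power [S^p(Q)]
    of the adjoint module [Q = L / R].  The [p]-th powers [v ^ p] are
    [L]-invariant, because [x . v ^ p = p v ^ (p-1) (x . v) = 0].  Dualizing,
    the splitting provides [D]-invariant functionals on [S^p(Q)] that separate
    [p]-th powers ([rep_power_separating]).  But if [v = x . w] and [x . v = 0],
    then [v ^ p = x . (w v ^ (p-1))] is killed by every [D]-invariant
    functional; hence [x . (x . w) = 0] forces [x . w = 0], for all [x] in [D]
    and even in [K D] for an extension field [K] ([kernel_square]).

    Some [a] in [D] acts on [Q] as a nonzero operator.  By the last remark it
    is not nilpotent, so over some [K] it has an eigenvector [x] in [K Q], with
    [[a, x] = z x] and [z != 0]; such an [x] comes from [K D].  Then
    [x . a = - z x != 0] and [x . (x . a) = - z [x, x] = 0], which is absurd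
    ([h1_not_vanishing]). *)

(** * Subspaces of finite-dimensional spaces *)

Definition subspace (F : fieldType) (V : lmodType F) (W : set V) : Prop :=
  W 0 /\ forall a u v, W u -> W v -> W (a *: u + v).

Section Subspaces.
Variables (F : fieldType) (V : lmodType F).
Implicit Types (W : set V) (u v : V).

Lemma subspaceD W u v : subspace W -> W u -> W v -> W (u + v).
Proof. by move=> [_ WP] Wu Wv; rewrite -[u]scale1r; apply: WP. Qed.

Lemma subspaceZ W a u : subspace W -> W u -> W (a *: u).
Proof. by move=> [W0 WP] Wu; rewrite -[_ *: _]addr0; apply: WP. Qed.

Lemma subspaceN W u : subspace W -> W u -> W (- u).
Proof. by move=> sW Wu; rewrite -scaleN1r; apply: subspaceZ. Qed.

Lemma subspaceB W u v : subspace W -> W u -> W v -> W (u - v).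
Proof. by move=> sW Wu Wv; apply: subspaceD => //; apply: subspaceN. Qed.

Lemma subspaceI W W' : subspace W -> subspace W' -> subspace (W `&` W').
Proof.
move=> [W0 WP] [W'0 W'P]; split=> [|a u v [Wu W'u] [Wv W'v]]; first by split.
by split; [apply: WP|apply: W'P].
Qed.

Lemma subspace_set0 : subspace [set (0 : V)].
Proof. by split=> // a u v -> ->; rewrite scaler0 addr0. Qed.

End Subspaces.

Section FiniteDimension.
Variables (F : fieldType) (V : vectType F).
Implicit Types (W : set V) (U : {vspace V}) (Q : set (set V)).

Lemma vspace_subspace U : subspace [set u | u \in U].
Proof. by split=> [|a u v uU vU] /=; [apply: mem0v|rewrite memvD ?memvZ]. Qed.

(** Among the [vspace]s contained in [W], one of largest dimension is all of
    [W], since otherwise a vector of [W] could be added to it. *)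
Lemma subspace_vspace W :
  subspace W -> exists U, forall u, (u \in U) <-> W u.
Proof.
move=> sW; pose P n := `[< exists U, (forall u, u \in U -> W u) /\ \dim U = n >].
have P0 : exists n, P n.
  exists 0%N; apply/asboolP; exists 0%VS; split; last exact: dimv0.
  by move=> u; rewrite memv0 => /eqP ->; case: sW.
have Pub n : P n -> (n <= \dim {:V})%N.
  by move=> /asboolP [U [_ <-]]; rewrite dimvS ?subvf.
case: (ex_maxnP P0 Pub) => _ /asboolP [U [sUW <-]] Umax.
exists U => u; split=> [|Wu]; first exact: sUW.
have sUuW v : v \in (U + <[u]>)%VS -> W v.
  move=> /memv_addP [w wU [_ /vlineP [a ->] ->]].
  by apply: subspaceD => //; [apply: sUW|apply: subspaceZ].
have /Umax : P (\dim (U + <[u]>)%VS).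
  by apply/asboolP; exists (U + <[u]>)%VS.
move=> dimle; have /eqP -> : U == (U + <[u]>)%VS by rewrite eqEdim addvSl.
by rewrite memvE addvSr.
Qed.

(** These two principles replace every induction on dimension below, without
    changing the ambient space. *)
Lemma exists_min_subspace Q :
  (forall W, Q W -> subspace W) -> (exists W, Q W) ->
  exists W, Q W /\ forall W', Q W' -> W' `<=` W -> W `<=` W'.
Proof.
move=> Qsub [W1 QW1].
pose P n := `[< exists W U, [/\ Q W, forall u, (u \in U) <-> W u & \dim U = n] >].
have P0 : exists n, P n.
  have [U UE] := subspace_vspace (Qsub _ QW1).
  by exists (\dim U); apply/asboolP; exists W1, U.
case: (ex_minnP P0) => _ /asboolP [W [U [QW UE <-]]] Umin.
exists W; split=> // W' QW' sW'W u /UE uU.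
have [U' U'E] := subspace_vspace (Qsub _ QW').
have sU'U : (U' <= U)%VS by apply/subvP => v /U'E /sW'W /UE.
have /Umin dimle : P (\dim U') by apply/asboolP; exists W', U'.
have /eqP U'U : U' == U by rewrite eqEdim sU'U.
by apply/U'E; rewrite U'U.
Qed.

Lemma exists_max_subspace Q :
  (forall W, Q W -> subspace W) -> (exists W, Q W) ->
  exists W, Q W /\ forall W', Q W' -> W `<=` W' -> W' `<=` W.
Proof.
move=> Qsub [W1 QW1].
pose P n := `[< exists W U, [/\ Q W, forall u, (u \in U) <-> W u & \dim U = n] >].
have P0 : exists n, P n.
  have [U UE] := subspace_vspace (Qsub _ QW1).
  by exists (\dim U); apply/asboolP; exists W1, U.
have Pub n : P n -> (n <= \dim {:V})%N.
  by move=> /asboolP [W [U [_ _ <-]]]; rewrite dimvS ?subvf.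
case: (ex_maxnP P0 Pub) => _ /asboolP [W [U [QW UE <-]]] Umax.
exists W; split=> // W' QW' sWW' u W'u.
have [U' U'E] := subspace_vspace (Qsub _ QW').
have sUU' : (U <= U')%VS by apply/subvP => v /UE /sWW' /U'E.
have /Umax dimle : P (\dim U') by apply/asboolP; exists W', U'.
have /eqP U'U : U == U' by rewrite eqEdim sUU'.
by apply/UE; rewrite U'U; apply/U'E.
Qed.

End FiniteDimension.

(** * Modules and their subquotients *)

HB.instance Definition _ (F : fieldType) (L : lieAlgType F) (M : lmodType F)
  (rho : lie_action L M) (x : L) :=
  GRing.isLinear.Build F M M _ (rho x) (lie_act_linearr rho x).

Section Actions.
Variables (F : fieldType) (L : lieAlgType F) (M : lmodType F).
Variable rho : lie_action L M.
Implicit Types (x y : L) (u v : M) (U W : set M) (A : set L).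

Lemma lie_actDl x y u : rho (x + y) u = rho x u + rho y u.
Proof. by have /= := lie_act_linearl rho u 1 x y; rewrite !scale1r. Qed.

Lemma lie_actDr x u v : rho x (u + v) = rho x u + rho x v.
Proof. exact: raddfD. Qed.

Lemma lie_actBr x u v : rho x (u - v) = rho x u - rho x v.
Proof. exact: raddfB. Qed.

Lemma lie_act0l u : rho 0 u = 0.
Proof. by apply: (addrI (rho 0 u)); rewrite -lie_actDl !addr0. Qed.

Definition stable A W : Prop := forall x u, A x -> W u -> W (rho x u).

Definition killed A : Prop := forall x u, A x -> rho x u = 0.

Lemma submodule_subspace W : is_submodule rho W -> subspace W.
Proof. by case. Qed.

Lemma submodule_stable A W : is_submodule rho W -> stable A W.
Proof. by move=> [_ _ WA] x u _; apply: WA. Qed.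

End Actions.

Section Subquotients.
Variables (F : fieldType) (L : lieAlgType F) (V : vectType F).
Variable rho : lie_action L V.

(** The quotient of a submodule [U] by a submodule [U1], realized on a linear
    complement of [U1] in [U] so that it is again a space with a basis: [q] is
    the projection onto the complement and [s] its inclusion. *)
Lemma subquotient (U U1 : set V) :
  is_submodule rho U -> is_submodule rho U1 -> U1 `<=` U ->
  exists (S : vectType F) (sigma : lie_action L S)
    (q : {linear V -> S}) (s : {linear S -> V}),
    [/\ forall x u, U u -> q (rho x u) = sigma x (q u),
        forall u, U u -> (q u = 0 <-> U1 u),
        forall y, U (s y) & cancel s q].
Proof.
move=> mU mU1 sU1U.
have sU := submodule_subspace mU; have sU1 := submodule_subspace mU1.
have [A AE] := subspace_vspace sU; have [B BE] := subspace_vspace sU1.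
have sBA : (B <= A)%VS by apply/subvP => u /BE /sU1U /AE.
pose C := (A :\: B)%VS.
pose q : {linear V -> subvs_of C} := vsproj C \o addv_pi1 A B.
pose s : {linear subvs_of C -> V} := @vsval _ _ C.
have Us y : U (s y) by apply/AE/(subvP (diffvSl A B))/subvsP.
have sq u : s (q u) = addv_pi1 A B u.
  by rewrite /s /q /= vsprojK // /addv_pi1 memv_pi.
have qs : cancel s q.
  move=> y; rewrite /q /= /addv_pi1 daddv_pi_id ?capv_diff ?subvsP //.
  exact: vsvalK.
have U1sq u : U u -> U1 (u - s (q u)).
  move=> /AE uA; apply/BE; have uAB : u \in (A + B)%VS.
    by rewrite -[u]addr0 memv_add ?mem0v.
  by rewrite sq -{1}(addv_pi1_pi2 uAB) addrC addKr memv_pi2.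
have qU1 u : U1 u -> q u = 0.
  move=> /BE uB; have uAB : u \in (A + B)%VS.
    by rewrite -[u]add0r memv_add ?mem0v.
  have e := addv_pi1_pi2 uAB; rewrite (addv_pi2_id A uB) in e.
  apply: subvs_inj; rewrite [vsval _]sq linear0.
  by apply: (addIr u); rewrite e add0r.
have qrho x u : U u -> q (rho x (s (q u))) = q (rho x u).
  move=> Uu; apply/esym/eqP; rewrite -subr_eq0 -!raddfB; apply/eqP.
  by apply/qU1; have [_ _ st] := mU1; apply/st/U1sq.
pose act x y := q (rho x (s y)).
have act_l y : linear (act^~ y).
  by move=> a x x'; rewrite /act (lie_act_linearl rho) linearP.
have act_r x : linear (act x) by move=> a y y'; rewrite /act !linearP.
have act_lie x x' y :
    act (lie x x') y = act x (act x' y) - act x' (act x y).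
  have [_ _ st] := mU.
  by rewrite /act !qrho ?lie_act_lie ?raddfB //; apply/st/Us.
exists (subvs_of C), (LieAction act_l act_r act_lie), q, s; split=> //.
  by move=> x u Uu; rewrite /= /act qrho.
move=> u Uu; split=> [qu0|]; last exact: qU1.
by have := U1sq u Uu; rewrite qu0 (_ : s 0 = 0) ?subr0 // raddf0.
Qed.

(** Submodules of the quotient pull back to submodules between [U1] and [U]. *)
Lemma irreducible_subquotient (U U1 : set V) :
  is_submodule rho U -> is_submodule rho U1 -> U1 `<=` U ->
  ~ (U `<=` U1) ->
  (forall W, is_submodule rho W -> U1 `<=` W -> W `<=` U -> ~ (U `<=` W) ->
     W `<=` U1) ->
  exists (S : vectType F) (sigma : lie_action L S)
    (q : {linear V -> S}) (s : {linear S -> V}),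
    [/\ forall x u, U u -> q (rho x u) = sigma x (q u),
        forall u, U u -> (q u = 0 <-> U1 u),
        forall y, U (s y) & cancel s q] /\ lie_irreducible sigma.
Proof.
move=> mU mU1 sU1U nUU1 U1max.
have [S [sigma [q [s [qact qker Us qs]]]]] := subquotient mU mU1 sU1U.
exists S, sigma, q, s; split=> //; split.
  apply: contrapT => nS; apply: nUU1 => u Uu; apply/qker => //.
  by apply: contrapT => /eqP qu0; apply: nS; exists (q u).
move=> W [W0 WP Wst]; have [U0 UP Ust] := mU.
pose W' := [set u | U u /\ W (q u)].
have mW' : is_submodule rho W'.
  split.
  - by split; rewrite ?raddf0.
  - by move=> a u v [Uu Wu] [Uv Wv]; split; [apply: UP|rewrite linearP; apply: WP].
  - by move=> x u [Uu Wu]; split; [apply: Ust|rewrite qact //; apply: Wst].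
have sU1W' : U1 `<=` W'.
  by move=> u U1u; split; [apply: sU1U|rewrite (qker _ _).2 //; apply: sU1U].
have [UW'|nUW'] := pselect (U `<=` W').
  right; apply/seteqP; split=> // y _.
  by have [_] := UW' _ (Us y); rewrite qs.
left; apply/seteqP; split=> [y Wy|y ->] //=.
rewrite -(qs y); apply/qker => //; apply: (U1max W') => //.
- by move=> u [].
- by split=> //=; rewrite qs.
Qed.

End Subquotients.

(** * Modules without trivial sections *)

Section TrivialFree.
Variables (F : fieldType) (L : lieAlgType F).
Implicit Types (D R : set L).

Definition ideal D : Prop :=
  subspace D /\ forall x d, D d -> D (lie x d).

Definition perfect D : Prop :=
  forall W, subspace W -> (forall d e, D d -> D e -> W (lie d e)) -> D `<=` W.

(** No nonzero quotient of [D]-submodules of [U] is a trivial [D]-module.  The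
    condition is phrased by elements of [U] so that it passes to submodules at
    once and needs no quotient space. *)
Definition trivial_free D (V : lmodType F) (rho : lie_action L V) (U : set V)
    : Prop :=
  forall W, subspace W -> stable rho D W -> W `<=` U ->
  forall u, U u -> (forall d, D d -> W (rho d u)) -> W u.

(** If [W] is a [D]-submodule and [x] is in [L], then [(W + x W) / W] is a
    quotient of the [D]-module [W]: since [[d, x]] is in [D], the map
    [w |-> x . w] commutes with [D] modulo [W].  Hence [W + x W] has no trivial
    section if [W] has none, and a largest such [W] is an [L]-submodule.  It is
    not zero, because a minimal [D]-submodule [W0] is not trivial: the
    [D]-invariants form an [L]-submodule. *)
Lemma irreducible_trivial_free D (S : vectType F) (rho : lie_action L S) :
  ideal D -> lie_irreducible rho -> ~ killed rho D ->
  trivial_free D rho setT.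
Proof.
move=> [sD Dlie] [_ irr] nDS.
have [W0 [[sW0 stW0 [w [W0w nw0]]] W0min]] : exists W,
    [/\ subspace W, stable rho D W & exists w, W w /\ w != 0] /\
    forall W', [/\ subspace W', stable rho D W' & exists w, W' w /\ w != 0] ->
    W' `<=` W -> W `<=` W'.
  apply: exists_min_subspace => [W []//|]; exists setT; split=> //.
  apply: contrapT => n0; apply: nDS => d u _; apply: contrapT => /eqP nu.
  by apply: n0; exists (rho d u).
have inv0 u : (forall d, D d -> rho d u = 0) -> u = 0.
  move=> u0; pose W := [set v | forall d, D d -> rho d v = 0].
  have mW : is_submodule rho W.
    split=> [d _|a v v' Wv Wv' d Dd|x v Wv d Dd]; first exact: lie_act0r.
      by rewrite linearP /= Wv ?Wv' // scaler0 addr0.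
    have e := lie_act_lie rho x d v.
    rewrite (Wv _ (Dlie x d Dd)) (Wv _ Dd) lie_act0r sub0r in e.
    by apply/eqP; rewrite -oppr_eq0 -e.
  case: (irr W mW) => [WE|WE]; first by have : W u by []; rewrite WE.
  by case: nDS => d v Dd; have : W v by [rewrite WE]; apply.
have tfW0 : trivial_free D rho W0.
  move=> W sW stW sWW0 u W0u Du; 
  have [[v [Wv nv]]|n0] := pselect (exists v, W v /\ v != 0).
    by apply: (W0min W) => //; split=> //; exists v.
  suff -> : u = 0 by case: sW.
  apply: inv0 => d /Du Wdu; apply: contrapT => /eqP nz.
  by apply: n0; exists (rho d u).
have [U [[sU stU tfU sW0U] Umax]] : exists W,
    [/\ subspace W, stable rho D W, trivial_free D rho W & W0 `<=` W] /\
    forall W', [/\ subspace W', stable rho D W', trivial_free D rho W' & W0 `<=` W'] ->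
    W `<=` W' -> W' `<=` W.
  by apply: exists_max_subspace => [W []//|]; exists W0; split.
suff mU : is_submodule rho U.
  case: (irr U mU) => [U0|<-//].
  by move: (sW0U _ W0w); rewrite U0 => /= w0; rewrite w0 eqxx in nw0.
have [U_0 UP] := sU; split=> // x u Uu.
have lieDx d : D d -> D (lie d x).
  by move=> Dd; rewrite lieC; apply: subspaceN => //; apply: Dlie.
have swap d v : rho d (rho x v) = rho x (rho d v) + rho (lie d x) v.
  by rewrite (lie_act_lie rho d x v) addrCA subrr addr0.
(* By maximality of [U] it is enough that [U + x U] qualifies too. *)
pose U' := [set w | exists u1 u2, [/\ U u1, U u2 & w = u1 + rho x u2]].
have sUU' : U `<=` U'.
  by move=> v Uv; exists v, 0; rewrite lie_act0r addr0; split.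
suff : U' `<=` U by apply; exists 0, u; rewrite add0r; split.
apply: Umax => //; split=> //.
- split; first exact: sUU'.
  move=> a _ _ [u1 [u2 [Uu1 Uu2 ->]]] [v1 [v2 [Uv1 Uv2 ->]]].
  exists (a *: u1 + v1), (a *: u2 + v2); split; try exact: UP.
  by rewrite linearP scalerDr addrACA.
- move=> d _ Dd [u1 [u2 [Uu1 Uu2 ->]]].
  exists (rho d u1 + rho (lie d x) u2), (rho d u2); split.
  + by apply: subspaceD => //; apply: stU => //; apply: lieDx.
  + exact: stU.
  + by rewrite raddfD /= swap -addrA [_ + rho x _]addrC.
- move=> W sW stW sWU' _ [u1 [u2 [Uu1 Uu2 ->]]] DW.
  (* First compare with the section [U' / U], through its preimage [V] in [U];
     what remains lies in [U]. *)
  pose V := [set v | U v /\ exists u3, U u3 /\ W (rho x v - u3)].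
  have [u3 [Uu3 Wu3]] : exists u3, U u3 /\ W (rho x u2 - u3).
    suff : V u2 by move=> [].
    apply: (tfU V) => //.
    + split.
        split=> //; exists 0; rewrite lie_act0r subr0.
        by split; last case: sW.
      move=> a v v' [Uv [w3 [Uw3 Ww3]]] [Uv' [w3' [Uw3' Ww3']]].
      split; first exact: UP.
      exists (a *: w3 + w3'); split; first exact: UP.
      by rewrite linearP opprD addrACA -scalerBr; apply: sW.2.
    + move=> d v Dd [Uv [w3 [Uw3 Ww3]]]; split; first exact: stU.
      exists (rho d w3 - rho (lie d x) v); split.
        by apply: subspaceB => //; apply: stU => //; apply: lieDx.
      have := stW _ _ Dd Ww3; rewrite raddfB /= swap.
      by rewrite opprB addrA.
    + by move=> v [].
    + move=> d Dd; split; first exact: stU.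
      exists (- (rho (lie d x) u2 + rho d u1)); split.
        apply: (subspaceN sU); apply: (subspaceD sU); apply: stU => //.
        exact: lieDx.
      have := DW _ Dd; rewrite raddfD /= swap opprK.
      by rewrite addrC -addrA.
  pose u4 := u1 + u3.
  have e : u1 + rho x u2 = u4 + (rho x u2 - u3) by rewrite /u4 addrACA subrr addr0.
  rewrite e; apply: subspaceD => //.
  have Uu4 : U u4 by apply: subspaceD.
  suff : W u4 /\ U u4 by move=> [].
  apply: (tfU (W `&` U)) => //.
  + exact: subspaceI.
  + by move=> d v Dd [Wv Uv]; split; [apply: stW|apply: stU].
  + move=> d Dd; split; last exact: stU.
    have -> : u4 = u1 + rho x u2 - (rho x u2 - u3) by rewrite e addrK.
    by rewrite raddfB; apply: subspaceB => //; [apply: DW|apply: stW].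
- exact: subset_trans sUU'.
Qed.

(** * Vanishing of the first cohomology *)

(** The 1-cocycles of [L / R], as maps on [L]; the quotient algebra itself is
    only needed to state the final result. *)
Definition cocycle1 R (M : lmodType F) (rho : lie_action L M) (f : L -> M)
    : Prop :=
  [/\ linear f, forall x, R x -> f x = 0
    & forall x y, f (lie x y) = rho x (f y) - rho y (f x)].

Definition h1_vanishes D R : Prop :=
  forall (S : vectType F) (rho : lie_action L S),
  lie_irreducible rho -> killed rho R -> ~ killed rho D ->
  forall f, cocycle1 R rho f -> exists s, forall x, f x = rho x s.

Lemma exists_maximal_submodule (V : vectType F) (rho : lie_action L V)
    (U : set V) :
  is_submodule rho U -> ~ (U `<=` [set 0]) ->
  exists U1, [/\ is_submodule rho U1, U1 `<=` U, ~ (U `<=` U1)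
    & forall W, is_submodule rho W -> U1 `<=` W -> W `<=` U -> ~ (U `<=` W) ->
      W `<=` U1].
Proof.
move=> [U_0 _ _] nU0.
have [U1 [[mU1 sU1 nUU1] U1max]] : exists W,
    [/\ is_submodule rho W, W `<=` U & ~ (U `<=` W)] /\
    forall W', [/\ is_submodule rho W', W' `<=` U & ~ (U `<=` W')] ->
    W `<=` W' -> W' `<=` W.
  apply: exists_max_subspace => [W [mW _ _]|]; first exact: submodule_subspace mW.
  exists [set 0]; split=> //; last by move=> _ ->.
  split=> // [a u v -> ->|x u ->]; first by rewrite scaler0 addr0.
  exact: lie_act0r.
by exists U1; split=> // W mW sU1W sWU nUW; apply: U1max.
Qed.

End TrivialFree.

Section Vanishing.
Variables (F : fieldType) (L : lieAlgType F).
Implicit Types (D R : set L).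

Lemma submodule_set0 (M : lmodType F) (rho : lie_action L M) :
  is_submodule rho [set 0].
Proof.
split=> // [a u v -> ->|x u ->]; first by rewrite scaler0 addr0.
exact: lie_act0r.
Qed.

(** Take a smallest submodule [U0] modulo which [f] becomes a coboundary on [U].
    If [U0] is not zero it has an irreducible quotient, which is not killed by
    [D] as [U] has no trivial section; the vanishing of [H^1] there allows a
    smaller choice. *)
Lemma h1_trivial_free D R (V : vectType F) (rho : lie_action L V) (U : set V)
    (f : L -> V) :
  h1_vanishes D R -> killed rho R -> is_submodule rho U ->
  trivial_free D rho U -> cocycle1 R rho f -> (forall x, U (f x)) ->
  exists u, U u /\ forall x, f x = rho x u.
Proof.
move=> van kR mU tfU [flin fR flie] fU; have [U_0 UP Ust] := mU.
have sU := submodule_subspace mU.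
have [U0 [[mU0 sU0U [u [Uu fU0]]] U0min]] : exists W,
    [/\ is_submodule rho W, W `<=` U
      & exists u, U u /\ forall x, W (f x - rho x u)] /\
    forall W', [/\ is_submodule rho W', W' `<=` U
      & exists u, U u /\ forall x, W' (f x - rho x u)] ->
    W' `<=` W -> W `<=` W'.
  apply: exists_min_subspace => [W [mW _ _]|]; first exact: submodule_subspace mW.
  by exists U; split=> //; exists 0; split=> // x; rewrite lie_act0r subr0.
have [U00|nU00] := pselect (U0 `<=` [set 0]).
  by exists u; split=> // x; apply/eqP; rewrite -subr_eq0; apply/eqP/U00.
have [U1 [mU1 sU1U0 nU0U1 U1max]] := exists_maximal_submodule mU0 nU00.
have [S [sigma [q [s [[qact qker U0s qs] irr]]]]] :=
  irreducible_subquotient mU0 mU1 sU1U0 nU0U1 U1max.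
have kRS : killed sigma R.
  by move=> x y Rx; rewrite -(qs y) -qact // kR // raddf0.
have nkD : ~ killed sigma D.
  move=> kD; apply: nU0U1 => v U0v.
  apply: tfU; [exact: submodule_subspace mU1|exact: submodule_stable mU1| | |].
  - exact: subset_trans sU0U.
  - exact: sU0U.
  - move=> d Dd; apply/qker; last by rewrite qact // kD.
    by have [_ _] := mU0; apply.
pose g x := q (f x - rho x u).
have [|y gy] := van S sigma irr kRS nkD g.
  split=> [a x y|x Rx|x y].
  - rewrite /g -linearP flin lie_act_linearl; congr (q _).
    by rewrite scalerBr opprD addrACA.
  - by rewrite /g fR // kR // subr0 raddf0.
  - rewrite /g -!qact // -raddfB flie lie_act_lie; congr (q _).
    by rewrite !lie_actBr !opprD addrACA.
have U0u' : U0 (s y) by [].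
exfalso; apply: nU0U1; apply: U0min => //; split=> //.
  exact: subset_trans sU0U.
exists (u + s y); split; first by apply: subspaceD => //; apply: sU0U.
have [_ _ U0st] := mU0.
move=> x; rewrite lie_actDr opprD addrA.
have U0fu : U0 (f x - rho x u - rho x (s y)).
  by apply: (subspaceB (submodule_subspace mU0)) => //; apply: U0st.
by apply/qker => //; rewrite raddfB /= -/(g x) gy qact // qs subrr.
Qed.

(** * Splitting off the trivial part *)

Section HomAction.
Variables (X S : vectType F) (rho : lie_action L X) (sigma : lie_action L S).

Definition hom_act (x : L) (g : 'Hom(X, S)) : 'Hom(X, S) :=
  ((linfun (sigma x) \o g) - (g \o linfun (rho x)))%VF.

Lemma hom_actE x (g : 'Hom(X, S)) u :
  hom_act x g u = sigma x (g u) - g (rho x u).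
Proof. by rewrite /hom_act add_lfunE opp_lfunE !comp_lfunE !lfunE. Qed.

Fact hom_act_linearl g : linear (hom_act^~ g).
Proof.
move=> a x y; apply/lfunP => u; rewrite /= hom_actE add_lfunE scale_lfunE !hom_actE.
rewrite (lie_act_linearl sigma) (lie_act_linearl rho) linearP /=.
by rewrite opprD addrACA scalerBr.
Qed.

Fact hom_act_linearr x : linear (hom_act x).
Proof.
move=> a g h; apply/lfunP => u.
rewrite !(hom_actE, add_lfunE, scale_lfunE) linearP /=.
by rewrite opprD addrACA scalerBr.
Qed.

Fact hom_act_lie x y g :
  hom_act (lie x y) g = hom_act x (hom_act y g) - hom_act y (hom_act x g).
Proof.
apply/lfunP => u; rewrite !(hom_actE, add_lfunE, opp_lfunE) !lie_act_lie.
rewrite !lie_actBr linearB /= !opprB.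
rewrite [RHS]addrACA !subrKA [LHS]addrACA [RHS]addrACA; congr (_ + _).
exact: addrC.
Qed.

Definition hom_action : lie_action L 'Hom(X, S) :=
  LieAction hom_act_linearl hom_act_linearr hom_act_lie.

Lemma killed_hom R : killed rho R -> killed sigma R -> killed hom_action R.
Proof.
move=> kX kS x g Rx; apply/lfunP => u.
by rewrite hom_actE kX // kS // raddf0 subr0 zero_lfunE.
Qed.

End HomAction.

(** The cocycle [x |-> x . g] takes its values in the maps [X -> S] that vanish
    on [N].  These form a module without trivial sections: as [D X] lies in [N],
    the algebra [D] acts on them through [S] only, so that evaluation at the
    vectors of a basis embeds them in a power of [S].  If [h] is a primitive of
    the cocycle, [g - h] is equivariant. *)
Lemma extend_equivariant D R (X S : vectType F) (rho : lie_action L X)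
    (sigma : lie_action L S) (N : set X) (g : 'Hom(X, S)) :
  h1_vanishes D R -> killed rho R -> killed sigma R ->
  is_submodule rho N -> (forall d u, D d -> N (rho d u)) ->
  trivial_free D sigma setT ->
  (forall x u, N u -> g (rho x u) = sigma x (g u)) ->
  exists h : 'Hom(X, S),
    (forall x u, h (rho x u) = sigma x (h u)) /\ forall u, N u -> h u = g u.
Proof.
move=> van kX kS mN DN tfS geq; have [N0 NP Nst] := mN.
pose tau := hom_action rho sigma.
have tauE x (h : 'Hom(X, S)) u : tau x h u = sigma x (h u) - h (rho x u).
  exact: hom_actE.
pose Y := [set h : 'Hom(X, S) | forall u, N u -> h u = 0].
have mY : is_submodule tau Y.
  split=> [u _|a h k Yh Yk u Nu|x h Yh u Nu]; first by rewrite zero_lfunE.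
    by rewrite add_lfunE scale_lfunE Yh // Yk // scaler0 addr0.
  by rewrite tauE !Yh ?lie_act0r ?subr0 //; apply: Nst.
have DY d (h : 'Hom(X, S)) u : D d -> Y h -> tau d h u = sigma d (h u).
  by move=> Dd Yh; rewrite tauE (Yh (rho d u)) ?subr0 //; apply: DN.
have tfY : trivial_free D tau Y.
  move=> W sW stW sWY h Yh DWh.
  (* One basis vector at a time, the value of [h] is matched inside [W]. *)
  suff eval (ts : seq X) : exists k, W k /\ forall t, t \in ts -> h t = k t.
    have [k [Wk hk]] := eval (vbasis {:X}).
    suff -> : h = k by [].
    apply/lfunP => u; rewrite (coord_vbasis (memvf u)) !linear_sum /=.
    apply: eq_bigr => i _; rewrite !linearZ /= hk //.
    by rewrite mem_nth ?size_tuple.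
  elim: ts => [|t ts [k [Wk hk]]]; first by exists 0; split=> //; case: sW.
  pose Wts := [set l | W l /\ forall t, t \in ts -> l t = 0].
  pose E := [set l t | l in Wts].
  have [l [Wl l0] lt] : E (h t - k t).
    apply: tfS => //.
    - split.
        exists 0; rewrite ?zero_lfunE //.
        by split=> [|v _]; [case: sW|rewrite zero_lfunE].
      move=> a _ _ [l [Wl l0] <-] [l' [Wl' l'0] <-].
      exists (a *: l + l'); last by rewrite add_lfunE scale_lfunE.
      split; first by apply: sW.2.
      by move=> v vts; rewrite add_lfunE scale_lfunE l0 // l'0 // scaler0 addr0.
    - move=> d _ Dd [l [Wl l0] <-]; exists (tau d l); last first.
        by rewrite DY //; apply: sWY.
      split=> [|v vts]; first exact: stW.
      by rewrite DY ?l0 ?lie_act0r //; apply: sWY.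
    - move=> d Dd; exists (tau d (h - k)).
        split=> [|v vts].
          by rewrite lie_actBr; apply: subspaceB => //; [apply: DWh|apply: stW].
        rewrite DY //; last first.
          by apply: (subspaceB (submodule_subspace mY)) => //; apply: sWY.
        by rewrite add_lfunE opp_lfunE hk // subrr lie_act0r.
      rewrite DY //; first by rewrite add_lfunE opp_lfunE.
      by apply: (subspaceB (submodule_subspace mY)) => //; apply: sWY.
  exists (k + l); split; first exact: subspaceD.
  move=> v; rewrite inE add_lfunE => /orP [/eqP ->|vts].
    by rewrite lt addrC subrK.
  by rewrite l0 // addr0 hk.
have [|||h [Yh hE]] := h1_trivial_free (f := fun x => tau x g) van _ mY tfY.
- exact: killed_hom.
- split=> [|x Rx|x y]; [exact: lie_act_linearl| |exact: lie_act_lie].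
  exact: (killed_hom kX kS).
- by move=> x u Nu; rewrite tauE geq // subrr.
exists (g - h); split=> [x u|u Nu]; last first.
  by rewrite add_lfunE opp_lfunE Yh // subr0.
have := congr1 (fun k : 'Hom(X, S) => k u) (hE x).
rewrite !tauE !add_lfunE !opp_lfunE lie_actBr => /eqP.
rewrite subr_eq => /eqP ->; rewrite [RHS]addrAC [X in _ = X + _]addrAC subrr sub0r.
exact: addrC.
Qed.

(** If [D] acts trivially on [V / N], every coset of [N] contains a
    [D]-invariant.  Take a smallest submodule [N0] of [N] such that every coset
    of [N] meets [X0], the set of vectors that [D] maps into [N0].  If [N0] is
    not zero, let [S = N0 / N1] be irreducible.  Either [D] kills [S], and then
    [D = [D, D]] maps [X0] into [N1]; or [extend_equivariant] provides an
    equivariant retraction of [X0 / N1] onto [S], whose kernel is a trivial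
    complement.  In both cases [N1] contradicts the choice of [N0]. *)
Lemma trivial_complement D R (V : vectType F) (rho : lie_action L V)
    (N : set V) :
  ideal D -> perfect D -> h1_vanishes D R -> killed rho R ->
  is_submodule rho N -> (forall d u, D d -> N (rho d u)) ->
  forall m, exists n, N n /\ forall d, D d -> rho d (m + n) = 0.
Proof.
move=> [sD Dlie] pD van kV mN DN.
have lieDx d x : D d -> D (lie d x).
  by move=> Dd; rewrite lieC; apply: subspaceN => //; apply: Dlie.
have [N0 [[mN0 sN0N dec0] N0min]] : exists W,
    [/\ is_submodule rho W, W `<=` N & forall m, exists n, N n /\
      forall d, D d -> W (rho d (m + n))] /\
    forall W', [/\ is_submodule rho W', W' `<=` N & forall m, exists n, N n /\
      forall d, D d -> W' (rho d (m + n))] -> W' `<=` W -> W `<=` W'.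
  apply: exists_min_subspace => [W [mW _ _]|]; first exact: submodule_subspace mW.
  exists N; split=> // m; exists 0; split; first by case: mN.
  by move=> d Dd; apply: DN.
have [N00|nN00] := pselect (N0 `<=` [set 0]).
  move=> m; have [n [Nn Wn]] := dec0 m; exists n; split=> // d Dd.
  exact/N00/Wn.
exfalso.
have [N1 [mN1 sN1N0 nN0N1 N1max]] := exists_maximal_submodule mN0 nN00.
have [S [sigma [q [s [[qact qker N0s qs] irr]]]]] :=
  irreducible_subquotient mN0 mN1 sN1N0 nN0N1 N1max.
apply: nN0N1; apply: N0min => //; split=> //; first exact: subset_trans sN0N.
have sN0 := submodule_subspace mN0; have [N0_0 N0P N0st] := mN0.
have sN1 := submodule_subspace mN1; have [N1_0 N1P N1st] := mN1.
pose X0 := [set u | forall d, D d -> N0 (rho d u)].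
have step u : X0 u -> exists n, N0 n /\ forall d, D d -> N1 (rho d (u + n)).
  have [kD|nkD] := pselect (killed sigma D).
    move=> X0u; exists 0; split=> //; rewrite addr0.
    have DN1 d v : D d -> N0 v -> N1 (rho d v).
      by move=> Dd N0v; apply/qker; [apply: N0st|rewrite qact // kD].
    apply: (pD [set d | N1 (rho d u)]) => [|d e Dd De].
      split=> [|a x y N1x N1y] /=; first by rewrite lie_act0l.
      by rewrite lie_act_linearl; apply: N1P.
    rewrite /= lie_act_lie; apply: (subspaceB sN1); apply: DN1 => //; exact: X0u.
  have mX0 : is_submodule rho X0.
    split=> [d _|a v w X0v X0w d Dd|x v X0v d Dd]; first by rewrite lie_act0r.
      by rewrite lie_act_linearr; apply: N0P; [apply: X0v|apply: X0w].
    have -> : rho d (rho x v) = rho (lie d x) v + rho x (rho d v).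
      by rewrite lie_act_lie subrK.
    by apply: (subspaceD sN0); [apply/X0v/lieDx|apply/N0st/X0v].
  have sN0X0 : N0 `<=` X0 by move=> v N0v d _; apply: N0st.
  (* [X] is the submodule [X0] as a space of its own, with inclusion [t]. *)
  have [|X [tau [p [t [pact pker X0t pt]]]]] :=
    subquotient mX0 (submodule_set0 rho) (_ : [set 0] `<=` X0).
    by move=> _ ->; case: mX0.
  have [_ _ X0st] := mX0; have sX0 := submodule_subspace mX0.
  have tp v : X0 v -> t (p v) = v.
    move=> X0v; apply/eqP; rewrite -subr_eq0; apply/eqP/pker.
      exact: (subspaceB sX0).
    by rewrite raddfB /= pt subrr.
  have tact x y : t (tau x y) = rho x (t y).
    by rewrite -{1}(pt y) -pact // tp //; apply: X0st.
  pose N' := [set y | N0 (t y)].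
  have mN' : is_submodule tau N'.
    split=> [|a y z N'y N'z|x y N'y]; rewrite /N' /=.
    - by rewrite raddf0.
    - by rewrite linearP; apply: N0P.
    - by rewrite tact; apply: N0st.
  have kX : killed tau R by move=> x y Rx; rewrite -(pt y) -pact // kV // raddf0.
  have kS : killed sigma R by move=> x y Rx; rewrite -(qs y) -qact // kV // raddf0.
  have tfS := irreducible_trivial_free (conj sD Dlie) irr nkD.
  have [|x y N'y|h [hact hN']] :=
    extend_equivariant (g := linfun (q \o t)) van kX kS mN' _ tfS _.
  - by move=> d y Dd; rewrite /N' /= tact; apply: X0t.
  - by rewrite !lfunE /= tact qact.
  move=> X0u; exists (- s (h (p u))); split; first exact: subspaceN.
  move=> d Dd; have N0du := X0u d Dd.
  apply/qker; first by rewrite lie_actBr; apply: (subspaceB sN0) => //; apply: N0st.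
  rewrite lie_actBr raddfB /= (qact d (s _)) // qs -hact -pact // hN'; last first.
    by rewrite /N' /= tp //; apply: sN0X0.
  by rewrite lfunE /= tp ?subrr //; apply: sN0X0.
move=> m; have [n [Nn X0mn]] := dec0 m.
have [n' [N0n' N1d]] := step _ X0mn.
exists (n + n'); split; last by rewrite addrA.
by apply: (subspaceD (submodule_subspace mN)) => //; apply: sN0N.
Qed.

Definition trivial_act (x : L) (a : F^o) : F^o := 0.

Fact trivial_act_linearl m : linear (trivial_act^~ m).
Proof. by move=> a x y; rewrite /trivial_act scaler0 addr0. Qed.

Fact trivial_act_linearr x : linear (trivial_act x).
Proof. by move=> a u v; rewrite /trivial_act scaler0 addr0. Qed.

Fact trivial_act_lie x y m : trivial_act (lie x y) m
  = trivial_act x (trivial_act y m) - trivial_act y (trivial_act x m).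
Proof. by rewrite /trivial_act subrr. Qed.

Definition trivial_action : lie_action L F^o :=
  LieAction trivial_act_linearl trivial_act_linearr trivial_act_lie.

(** In the dual of [V], the functionals vanishing on the [L]-invariants form a
    submodule that contains the whole image of the action, so the coset of [g]
    contains a [D]-invariant functional. *)
Lemma invariant_functional D R (V : vectType F) (rho : lie_action L V)
    (g : 'Hom(V, F^o)) :
  ideal D -> perfect D -> h1_vanishes D R -> killed rho R ->
  exists h : 'Hom(V, F^o),
    (forall d u, D d -> h (rho d u) = 0) /\
    (forall u, (forall x, rho x u = 0) -> h u = g u).
Proof.
move=> iD pD van kV; pose tau := hom_action rho trivial_action.
have tauE x (h : 'Hom(V, F^o)) u : tau x h u = - h (rho x u).
  by have /= -> := hom_actE rho trivial_action x h u; rewrite sub0r.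
pose N := [set h : 'Hom(V, F^o) | forall u, (forall x, rho x u = 0) -> h u = 0].
have mN : is_submodule tau N.
  split=> [u _|a h k Nh Nk u u0|x h Nh u u0]; first by rewrite zero_lfunE.
    by rewrite add_lfunE scale_lfunE Nh // Nk // scaler0 addr0.
  by rewrite tauE u0 raddf0 oppr0.
have kH : killed tau R by apply: killed_hom => // x u _.
have DN d (h : 'Hom(V, F^o)) : D d -> N (tau d h).
  by move=> Dd u u0; rewrite tauE u0 raddf0 oppr0.
have [k [Nk Dk]] := trivial_complement iD pD van kH mN DN g.
exists (g + k); split=> [d u Dd|u u0].
  apply/eqP; rewrite -oppr_eq0 -tauE; apply/eqP.
  by rewrite [tau _ _]Dk // zero_lfunE.
by rewrite add_lfunE Nk // addr0.
Qed.

End Vanishing.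

(** * Symmetric powers in characteristic p *)

Section MatrixDerivations.
Variables (K : fieldType) (n : nat).
Implicit Types (r : 'rV[K]_n) (A B : 'M[K]_n) (f g : {mpoly K[n]}).

Definition linear_form r : {mpoly K[n]} := \sum_i r 0 i *: 'X_i.

Lemma linear_form_linear : linear linear_form.
Proof.
move=> a r s; rewrite /linear_form scaler_sumr -big_split; apply: eq_bigr => i _.
by rewrite !mxE scalerDl scalerA.
Qed.

HB.instance Definition _ := GRing.isLinear.Build K 'rV[K]_n {mpoly K[n]} _
  linear_form linear_form_linear.

Lemma linear_form_homog r : linear_form r \is 1.-homog.
Proof. by apply: rpred_sum => i _; apply: rpredZ; rewrite dhomogX /= mdeg1. Qed.

(** The derivation of the polynomial ring that extends the action [r |-> r *m A]
    on linear forms.  On polynomials of degree [d] it is the action induced on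
    the [d]-th symmetric power. *)
Definition mxderiv A g : {mpoly K[n]} := \sum_j linear_form (row j A) * g^`M(j).

Lemma mxderiv_linear A : linear (mxderiv A).
Proof.
move=> a f g; rewrite /mxderiv scaler_sumr -big_split; apply: eq_bigr => i _ /=.
by rewrite linearP mulrDr scalerAr.
Qed.

HB.instance Definition _ A := GRing.isLinear.Build K {mpoly K[n]} {mpoly K[n]} _
  (mxderiv A) (mxderiv_linear A).

Lemma mxderiv_linearl g : linear (mxderiv^~ g).
Proof.
move=> a A B; rewrite /mxderiv scaler_sumr -big_split; apply: eq_bigr => i _ /=.
by rewrite !linearP mulrDl scalerAl.
Qed.

Lemma mxderivM A f g :
  mxderiv A (f * g) = mxderiv A f * g + f * mxderiv A g.
Proof.
rewrite /mxderiv mulr_suml mulr_sumr -big_split; apply: eq_bigr => i _ /=.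
by rewrite mderivM mulrDr -mulrA [f * (_ * _)]mulrCA.
Qed.

Lemma mxderivX A g k : mxderiv A (g ^+ k) = (g ^+ k.-1 * mxderiv A g) *+ k.
Proof.
elim: k => [|k IHk].
  by rewrite expr0 mulr0n /mxderiv big1 // => i _; rewrite -mpolyC1 mderivC mulr0.
rewrite exprS mxderivM IHk [mxderiv A g * _]mulrC /= mulrS; congr (_ + _).
case: k {IHk} => [|k]; first by rewrite !mulr0n mulr0.
by rewrite mulrnAr mulrA -exprS.
Qed.

Lemma mxderiv_form A r : mxderiv A (linear_form r) = linear_form (r *m A).
Proof.
have -> : r *m A = \sum_j r 0 j *: row j A.
  by rewrite [LHS]mulmx_sum_row.
rewrite {1}/linear_form [LHS]linear_sum [RHS]linear_sum.
apply: eq_bigr => j _; rewrite !linearZ /=; congr (_ *: _).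
rewrite /mxderiv (bigD1 j) //= big1 => [|i ij].
  rewrite addr0 mderivX mnm1E eqxx scale1r -{1}[U_(j)%MM]add0m addmK.
  by rewrite mpolyX0 mulr1.
by rewrite mderivX mnm1E eq_sym (negPf ij) scale0r mulr0.
Qed.

(** A commutator of derivations is a derivation: the second-order terms are
    symmetric. *)
Lemma mxderiv_comm A B g :
  mxderiv (B *m A - A *m B) g
  = mxderiv A (mxderiv B g) - mxderiv B (mxderiv A g).
Proof.
have expand C E : mxderiv C (mxderiv E g) = mxderiv (E *m C) g
    + \sum_i \sum_j linear_form (row i E) * (linear_form (row j C)
                    * g^`M(i)^`M(j)).
  rewrite {2 3}/mxderiv linear_sum -big_split; apply: eq_bigr => i _ /=.
  by rewrite mxderivM mxderiv_form -row_mul /mxderiv mulr_sumr.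
rewrite !expand.
rewrite [X in _ = _ + X - _](_ : _ = \sum_i \sum_j linear_form (row i A)
          * (linear_form (row j B) * g^`M(i)^`M(j))).
  rewrite opprD addrACA subrr addr0.
  have /= := mxderiv_linearl g (- 1) (A *m B) (B *m A).
  by rewrite !scaleN1r ![- _ + _]addrC.
rewrite exchange_big; apply: eq_bigr => i _; apply: eq_bigr => j _.
by rewrite mulrCA mderiv_comm.
Qed.

Lemma mxderiv_homog A d g : g \is d.-homog -> mxderiv A g \is d.-homog.
Proof.
move=> /dhomogP gd; rewrite [g]mpolyE linear_sum big_seq.
apply: rpred_sum => m mg; rewrite linearZ; apply: rpredZ.
apply: rpred_sum => j _; rewrite mderivX.
have [->|mj] := eqVneq (m j) 0%N; first by rewrite scale0r mulr0 rpred0.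
have md : mdeg m = d := gd _ mg.
have d_gt0 : (0 < d)%N.
  by rewrite -md lt0n mdeg_eq0; apply: contraNneq mj => ->; rewrite mnm0E.
rewrite -(prednK d_gt0) -add1n; apply: dhomogM; first exact: linear_form_homog.
apply: rpredZ; rewrite dhomogX; apply/eqP.
have /submK em : (U_(j) <= m)%MM by rewrite lep1mP.
by rewrite /= -md -{2}em mdegD mdeg1 addn1.
Qed.

Lemma pchar_mpoly p : p \in [pchar K] -> p \in [pchar {mpoly K[n]}].
Proof.
move=> /andP [pr /eqP p0]; apply/andP; split=> //.
by rewrite -mpolyC_nat p0 mpolyC0.
Qed.

Lemma mxderiv_Frobenius p A g : p \in [pchar K] -> mxderiv A (g ^+ p) = 0.
Proof.
by move=> /pchar_mpoly pK; rewrite mxderivX -mulr_natl (pcharf0 pK) mul0r.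
Qed.

Lemma linear_form_Frobenius p r : p \in [pchar K] ->
  linear_form r ^+ p = \sum_i r 0 i ^+ p *: 'X_i ^+ p.
Proof.
move=> /pchar_mpoly pK; rewrite -(pFrobenius_autE pK) rmorph_sum /=.
by apply: eq_bigr => i _; rewrite pFrobenius_autE exprZn.
Qed.

End MatrixDerivations.

Section Pairing.
Variables (K : fieldType) (n p : nat).
Implicit Types (c : 'X_{1..n} -> K) (g : {mpoly K[n]}).

(** The functional on polynomials of degree at most [p] with value [c m] at the
    monomial [m].  Recording it by these values makes extension of scalars a
    mere composition with the field embedding. *)
Definition pairing c g : K := \sum_(m : 'X_{1..n < p.+1}) g@_m * c m.

Lemma pairing_linear c : linear (pairing c : {mpoly K[n]} -> K^o).
Proof.
move=> a f g; rewrite /pairing scaler_sumr -big_split; apply: eq_bigr => m _ /=.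
by rewrite mcoeffD mcoeffZ mulrDl -[in LHS]mulrA.
Qed.

HB.instance Definition _ c := GRing.isLinear.Build K {mpoly K[n]} K^o _
  (pairing c) (pairing_linear c).

Lemma pairing_sum c (I : Type) (r : seq I) (a : I -> K) (g : I -> {mpoly K[n]}) :
  pairing c (\sum_(i <- r) a i *: g i) = \sum_(i <- r) a i * pairing c (g i).
Proof.
rewrite (linear_sum (pairing c : {linear {mpoly K[n]} -> K^o})).
by apply: eq_bigr => i _; rewrite linearZ.
Qed.

Lemma pairing_monomial c m : mdeg m = p -> pairing c 'X_[m] = c m.
Proof.
move=> mp; have m_lt : (mdeg m < p.+1)%N by rewrite mp.
rewrite /pairing (bigD1 (BMultinom m_lt)) //= mcoeffX eqxx mul1r big1 ?addr0 //.
move=> m' nm; rewrite mcoeffX; case: eqP => [e|]; last by rewrite mul0r.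
by case/eqP: nm; apply/val_inj.
Qed.

Lemma pairing_Frobenius c r : p \in [pchar K] ->
  pairing c (linear_form r ^+ p) = \sum_i r 0 i ^+ p * c (U_(i) *+ p)%MM.
Proof.
move=> pK; rewrite linear_form_Frobenius // pairing_sum; apply: eq_bigr => i _.
by rewrite mpolyXn pairing_monomial // mdegMn mdeg1 mul1n.
Qed.

End Pairing.

Section BaseChange.
Variables (F K : fieldType) (iota : {rmorphism F -> K}) (n : nat).

Lemma map_mxderiv (A : 'M[F]_n) m :
  map_mpoly iota (mxderiv A 'X_[m]) = mxderiv (map_mx iota A) 'X_[m].
Proof.
rewrite /mxderiv rmorph_sum; apply: eq_bigr => j _ /=.
rewrite rmorphM !mderivX /= map_mpolyZ map_mpolyX rmorph_nat; congr (_ * _).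
rewrite /linear_form rmorph_sum; apply: eq_bigr => i _ /=.
by rewrite map_mpolyZ map_mpolyX !mxE.
Qed.

Lemma map_pairing p (c : 'X_{1..n} -> F) g :
  pairing p (iota \o c) (map_mpoly iota g) = iota (pairing p c g).
Proof.
rewrite /pairing rmorph_sum; apply: eq_bigr => m _ /=.
by rewrite mcoeff_map_mpoly rmorphM.
Qed.

Lemma pairing_invariant p (c : 'X_{1..n} -> F) (A : 'M[F]_n) :
  (forall f, f \is p.-homog -> pairing p c (mxderiv A f) = 0) ->
  forall g : {mpoly K[n]}, g \is p.-homog ->
  pairing p (iota \o c) (mxderiv (map_mx iota A) g) = 0.
Proof.
move=> c0 g /dhomogP gp; rewrite [g]mpolyE [mxderiv _ _]linear_sum.
under eq_bigr do rewrite linearZ /=.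
rewrite pairing_sum big_seq big1 // => m mg.
rewrite /= -map_mxderiv map_pairing c0 ?rmorph0 ?mulr0 //.
by rewrite dhomogX; apply/eqP/gp.
Qed.

(** The functionals on the [p]-th symmetric power that are invariant under [As]
    separate the [p]-th powers of linear forms: a dual basis to the powers of
    the variables occurs among them. *)
Definition power_separating p (As : set 'M[F]_n) : Prop :=
  forall j, exists c : 'X_{1..n} -> F,
    (forall A f, As A -> f \is p.-homog -> pairing p c (mxderiv A f) = 0) /\
    forall i, c (U_(i) *+ p)%MM = (i == j)%:R.

(** Let [v = w *m X] and [v *m X = 0].  The derivation [X] maps [w v ^ (p-1)] to
    [v ^ p], whose value under the [j]-th separating functional is
    [v_j ^ p]; by invariance this is zero. *)
Lemma kernel_square p (As : set 'M[F]_n) k (a : 'I_k -> K)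
    (A : 'I_k -> 'M[F]_n) (w : 'rV[K]_n) :
  p \in [pchar F] -> power_separating p As -> (forall i, As (A i)) ->
  let X := \sum_i a i *: map_mx iota (A i) in
  w *m X *m X = 0 -> w *m X = 0.
Proof.
move=> pF sep AsA X wXX; have pK : p \in [pchar K].
  by rewrite (fmorph_pchar iota).
have p_gt0 : (0 < p)%N by rewrite prime_gt0 // (pcharf_prime pF).
apply/rowP => j; have [c [c0 cE]] := sep j; rewrite [RHS]mxE.
set v := w *m X; pose g := linear_form w * linear_form v ^+ p.-1.
have gp : g \is p.-homog.
  rewrite -(prednK p_gt0) -add1n; apply: dhomogM; first exact: linear_form_homog.
  by rewrite -[X in X.-homog]mul1n; apply/dhomogMn/linear_form_homog.
have Xg : mxderiv X g = linear_form v ^+ p.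
  rewrite mxderivM mxderivX !mxderiv_form wXX linear0 mulr0 mul0rn mulr0 addr0.
  by rewrite -exprS prednK.
have Xg0 : pairing p (iota \o c) (mxderiv X g) = 0.
  have -> : mxderiv X g = \sum_i a i *: mxderiv (map_mx iota (A i)) g.
    rewrite /X; elim/big_rec2: _ => [|i y x _ <-].
      by rewrite /mxderiv big1 // => i _; rewrite row0 linear0 mul0r.
    exact: mxderiv_linearl.
  rewrite pairing_sum big1 // => i _; rewrite pairing_invariant ?mulr0 //.
  by move=> f; apply: c0.
move: Xg0; rewrite Xg pairing_Frobenius // (bigD1 j) //= big1 => [|i ij].
  by rewrite addr0 cE eqxx rmorph1 mulr1 => /eqP; rewrite expf_eq0 p_gt0 => /eqP.
by rewrite cE (negPf ij) rmorph0 mulr0.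
Qed.

End BaseChange.

Section SymmetricPower.
Variables (F : fieldType) (L : lieAlgType F) (n : nat).
Variable rep : L -> 'M[F]_n.+1.
Hypotheses (rep_linear : linear rep)
  (rep_lie : forall x y, rep (lie x y) = rep y *m rep x - rep x *m rep y).
Variable p : nat.

Definition sym_act x (u : dhomog n.+1 F p) : dhomog n.+1 F p :=
  DHomog (mxderiv_homog (rep x) (dhomog_is_dhomog u)).

Fact sym_act_linearl u : linear (sym_act^~ u).
Proof.
move=> a x y; apply/val_inj; rewrite /= rep_linear.
exact: mxderiv_linearl.
Qed.

Fact sym_act_linearr x : linear (sym_act x).
Proof. by move=> a u v; apply/val_inj; apply: mxderiv_linear. Qed.

Fact sym_act_lie x y u :
  sym_act (lie x y) u = sym_act x (sym_act y u) - sym_act y (sym_act x u).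
Proof. by apply/val_inj; rewrite /= rep_lie mxderiv_comm. Qed.

Definition sym_action : lie_action L (dhomog n.+1 F p) :=
  LieAction sym_act_linearl sym_act_linearr sym_act_lie.

Definition homog_coeff (m : 'X_{1..n.+1}) (u : dhomog n.+1 F p) : F^o := u@_m.

Fact homog_coeff_linear m : linear (homog_coeff m).
Proof.
move=> a u v; rewrite /homog_coeff (linearP (@mpoly_of_dhomog _ _ _)) /=.
by rewrite mcoeffD mcoeffZ.
Qed.

HB.instance Definition _ m := GRing.isLinear.Build F (dhomog n.+1 F p) F^o _
  (homog_coeff m) (homog_coeff_linear m).

(** [indhomog] sends polynomials that are not homogeneous of degree [p] to zero,
    so monomials of another degree contribute nothing. *)
Lemma functional_pairing (h : 'Hom(dhomog n.+1 F p, F^o)) u :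
  h u = pairing p (fun m => h (indhomog p 'X_[m])) u.
Proof.
have {1}-> : u = \sum_(m : 'X_{1..n.+1 < p.+1}) u@_m *: indhomog p 'X_[m].
  apply/val_inj; rewrite raddf_sum /=.
  have up : forall m, m \in msupp u -> mdeg m = p.
    by move=> m; apply/dhomogP/dhomog_is_dhomog.
  rewrite [LHS](mpolywE (k := p.+1)); last first.
    by rewrite msizeE; apply/bigmax_leqP_seq => m mu _; rewrite up.
  apply: eq_bigr => m _; have [mu|/memN_msupp_eq0 ->] := boolP (val m \in msupp u).
    by rewrite /= /indhomog insubdK // dhomogX /= up.
  by rewrite !scale0r.
rewrite linear_sum; apply: eq_bigr => m _.
by rewrite linearZ.
Qed.

(** The powers ['X_i ^+ p] are invariant under the whole of [L], so the
    coefficient of ['X_j ^+ p] can be replaced by a [D]-invariant functional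
    with the same values on them. *)
Lemma rep_power_separating (D R : set L) :
  p \in [pchar F] -> ideal D -> perfect D -> h1_vanishes D R ->
  (forall x, R x -> rep x = 0) ->
  power_separating p (rep @` D).
Proof.
move=> pF iD pD van R0 j.
have kR : killed sym_action R.
  move=> x u Rx; apply/val_inj; rewrite /= R0 // /mxderiv big1 // => i _.
  by rewrite row0 linear0 mul0r.
have [h [hD hI]] :=
  invariant_functional (linfun (homog_coeff (U_(j) *+ p)%MM)) iD pD van kR.
exists (fun m => h (indhomog p 'X_[m])); split.
  move=> _ f [d Dd <-] fp; pose u : dhomog n.+1 F p := DHomog fp.
  exact: etrans (esym (functional_pairing h (sym_act d u))) (hD d u Dd).
move=> i; have ip : 'X_[F, (U_(i) *+ p)%MM] \is p.-homog.
  by rewrite dhomogX /= mdegMn mdeg1 mul1n.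
rewrite hI => [|x].
  rewrite lfunE /= /homog_coeff /indhomog insubdK // mcoeffX.
  have p_gt0 : (0 < p)%N by rewrite prime_gt0 // (pcharf_prime pF).
  congr (nat_of_bool _)%:R; apply/eqP/eqP => [e|-> //].
  have := congr1 (fun m : 'X_{1..n.+1} => m i) e.
  rewrite !mulmnE !mnm1E eqxx mul1n.
  by case: eqP => // _ e0; rewrite e0 in p_gt0.
apply/val_inj; rewrite /= /indhomog insubdK // -mpolyXn.
exact: mxderiv_Frobenius.
Qed.

End SymmetricPower.

(** * Elements of the adjoint representation *)

Section Eigenvalue.
Variables (F : fieldType) (n : nat).

Lemma exists_irreducible_factor (g : {poly F}) :
  (1 < size g)%N -> exists h, irreducible_poly h /\ h %| g.
Proof.
move=> g_gt1; have g0 : g != 0 by rewrite -size_poly_gt0 (ltn_trans _ g_gt1).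
pose P k := `[< exists h, [/\ h %| g, (1 < size h)%N & size h = k] >].
have P0 : exists k, P k by exists (size g); apply/asboolP; exists g.
case: (ex_minnP P0) => _ /asboolP [h [hg h_gt1 <-]] hmin.
exists h; split=> //; split=> // q q1 qh; rewrite -dvdp_size_eqp //.
have h0 : h != 0 by rewrite -size_poly_gt0 (ltn_trans _ h_gt1).
rewrite eqn_leq dvdp_leq //= hmin //; apply/asboolP; exists q.
split=> //; first exact: dvdp_trans hg.
have : (0 < size q)%N.
  by rewrite size_poly_gt0; apply: contraTneq qh => ->; rewrite dvd0p.
by case: (size q) q1 => [|[|]].
Qed.

(** Write the characteristic polynomial as ['X^m * g] with [g] nonzero at 0.  If
    [g] is constant, the Cayley-Hamilton theorem gives nilpotency; otherwise
    adjoin a root of an irreducible factor of [g]. *)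
Lemma nilpotent_or_eigenvector (A : 'M[F]_n.+1) :
  (exists k, A ^+ k = 0) \/
  exists (K : fieldType) (iota : {rmorphism F -> K}) (z : K) (c : 'rV[K]_n.+1),
    [/\ z != 0, c != 0 & c *m map_mx iota A = z *: c].
Proof.
have nz : char_poly A != 0 by rewrite monic_neq0 ?char_poly_monic.
have [m [g]] := multiplicity_XsubC (char_poly A) 0; rewrite nz /= subr0 => g00 gE.
have g0 : g != 0 by apply: contraNneq g00 => ->; rewrite root0.
have [g1|g_gt1] := leqP (size g) 1.
  left; exists m; have [b gb] : exists b, g = b%:P.
    by exists g`_0; apply: size1_polyC.
  have b0 : b != 0 by apply: contraNneq g0; rewrite gb => ->.
  have := Cayley_Hamilton A; rewrite gE gb mul_polyC linearZ /= rmorphXn /=.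
  by rewrite horner_mx_X => /eqP; rewrite scaler_eq0 (negPf b0) => /eqP.
right; have [h [h_irr hg]] := exists_irreducible_factor g_gt1.
have [K _ [z hz _]] := irredp_FAdjoin h_irr.
pose iota : {rmorphism F -> K} := in_alg K.
have gz : root (map_poly iota g) z.
  by apply: root_dvdp hz; rewrite dvdp_map.
have : eigenvalue (map_mx iota A) z.
  rewrite eigenvalue_root_char -map_char_poly gE rmorphM rootM.
  by apply/orP; left.
move=> /eigenvalueP [c cA c0]; exists K, iota, z, c; split=> //.
by apply: contraNneq g00 => z0; rewrite -(fmorph_root iota) rmorph0 -z0.
Qed.

End Eigenvalue.

(** Terms are paired off across the diagonal; in characteristic 2 antisymmetry
    alone would not do, hence the first hypothesis. *)
Lemma sum_alternating (V : zmodType) n (f : 'I_n -> 'I_n -> V) :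
  (forall i, f i i = 0) -> (forall i j, f i j = - f j i) ->
  \sum_i \sum_j f i j = 0.
Proof.
move=> f0 fC; rewrite pair_big /=.
pose s1 := \sum_(u : 'I_n * 'I_n | (u.1 < u.2)%N) f u.1 u.2.
rewrite (bigID (fun u : 'I_n * 'I_n => (u.1 < u.2)%N)) /= -/s1.
rewrite (bigID (fun u : 'I_n * 'I_n => (u.2 < u.1)%N)) /= addrA.
rewrite [X in _ + X]big1 => [|[i j] /= /andP [ij ji]]; last first.
  by have /eqP/val_inj -> : val i == val j by rewrite eqn_leq leqNgt ji leqNgt ij.
rewrite addr0 (reindex_inj (h := fun u : 'I_n * 'I_n => (u.2, u.1))) /=; last first.
  by move=> [i j] [k l] [-> ->].
rewrite [X in _ + X](_ : _ = - s1) ?subrr // /s1 -sumrN.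
apply: eq_big => [[i j]|[i j] _] /=; last exact: fC.
by case: ltngtP.
Qed.

Lemma kernel_square_nilpotent (F : fieldType) (n p : nat)
    (As : set 'M[F]_n.+1) (A : 'M[F]_n.+1) k :
  p \in [pchar F] -> power_separating p As -> As A -> A ^+ k = 0 -> A = 0.
Proof.
move=> pF sep AsA; elim: k => [|k IHk] Ak.
  by rewrite -[A]mulr1 -(expr0 A) Ak mulr0.
case: k => [|k] in Ak IHk *; first by rewrite -[A]expr1.
apply: IHk; apply/row_matrixP => i; rewrite row0 exprSr row_mul.
have := @kernel_square F F idfun n.+1 p As 1 (fun=> 1) (fun=> A) (row i (A ^+ k)).
rewrite big_ord1 scale1r map_mx_id //; apply=> //.
by rewrite -!row_mul !mulmxE -!exprSr Ak row0.
Qed.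

Section AdjointQuotient.
Variables (F : fieldType) (L : finDimLieAlgType F).

Fact lie_lie (x y z : L) :
  lie (lie x y) z = lie x (lie y z) - lie y (lie x z).
Proof.
have := lie_jacobi x y z => /eqP.
by rewrite (lieC z x) (lieC z (lie x y)) lieNr subr_eq0 => /eqP.
Qed.

Definition adjoint : lie_action L L :=
  LieAction (@lie_linearl F L) (@lie_linearr F L) lie_lie.

(** The adjoint representation on [L / R] in matrix form: [q] takes
    coordinates of cosets and [s] chooses representatives. *)
Lemma adjoint_quotient_rep (R : set L) :
  ideal R -> ~ ([set: L] `<=` R) ->
  exists (n : nat) (rep : L -> 'M[F]_n.+1) (q : {linear L -> 'rV[F]_n.+1})
    (s : 'rV[F]_n.+1 -> L),
    [/\ linear rep,
        forall x y, rep (lie x y) = rep y *m rep x - rep x *m rep y,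
        forall x u, q (lie x u) = q u *m rep x,
        forall u, q u = 0 <-> R u
      & cancel s q].
Proof.
move=> [sR Rlie] nR.
have mR : is_submodule adjoint R by have [R0 RP] := sR; split.
have mL : is_submodule adjoint setT by [].
have [S [sigma [q [s [qact qker _ qs]]]]] := subquotient mL mR (@subsetT _ _).
have [m [v [w [vw wv]]]] : exists m (v : {linear S -> 'rV[F]_m})
    (w : {linear 'rV[F]_m -> S}), cancel v w /\ cancel w v.
  pose e := vbasis {:S}; have eb : basis_of {:S} e := vbasisP _.
  exists (\dim {:S}), (rVof e), (vecof e).
  by split; [apply: rVofK|apply: vecofK].
case: m v w vw wv => [|n] v w vw wv.
  case: nR => u _; apply/qker => //; apply: (can_inj vw).
  by apply/rowP => - [].
pose rep x := lin1_mx (v \o sigma x \o w).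
have repE r x : r *m rep x = v (sigma x (w r)) by rewrite mul_rV_lin1.
have mx_ext (A B : 'M[F]_n.+1) : (forall r : 'rV[F]_n.+1, r *m A = r *m B) -> A = B.
  by move=> AB; apply/row_matrixP => i; rewrite !rowE.
exists n, rep, (v \o q), (s \o w); split.
- move=> a x y; apply: mx_ext => r.
  by rewrite mulmxDr -scalemxAr !repE (lie_act_linearl sigma) linearP.
- move=> x y; apply: mx_ext => r.
  by rewrite mulmxBr !mulmxA !repE !vw lie_act_lie linearB.
- by move=> x u; rewrite repE /= vw -qact.
- move=> u /=; split=> [e|Ru]; last by rewrite (qker _ _).2 // linear0.
  by apply/qker => //; apply: (can_inj vw); rewrite e linear0.
- by move=> r /=; rewrite qs wv.
Qed.

End AdjointQuotient.

(** * The ideals D and R *)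

Section NonsolvablePart.
Variables (F : fieldType) (L : finDimLieAlgType F).

Lemma lie_prodv_ideal (U : {vspace L}) :
  ideal [set u | u \in U] -> ideal [set u | u \in lie_prodv U U].
Proof.
move=> [_ Ulie]; split=> [|x d dU]; first exact: vspace_subspace.
have prodU y z : y \in U -> z \in U -> lie y z \in lie_prodv U U.
  by move=> yU zU; have /lie_prodv_subP := subvv (lie_prodv U U); apply.
have : (lie_prodv U U <= linfun (adjoint L x) @^-1: lie_prodv U U)%VS.
  apply/lie_prodv_subP => y z yU zU; rewrite -memv_preim lfunE /=.
  have -> : lie x (lie y z) = lie (lie x y) z + lie y (lie x z).
    by rewrite lie_lie subrK.
  by rewrite memvD ?prodU ?Ulie.
by move=> /subvP /(_ d dU); rewrite -memv_preim lfunE.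
Qed.

(** A term of the derived series of least dimension equals the next one. *)
Lemma exists_perfect_ideal :
  ~ lie_solvable L ->
  exists D : set L, [/\ ideal D, perfect D & ~ (D `<=` [set 0])].
Proof.
move=> nsol; pose U k := derived_series L k.
have Uideal k : ideal [set u | u \in U k].
  elim: k => [|k IHk]; last exact: lie_prodv_ideal.
  by split=> [|x d _]; [exact: vspace_subspace|rewrite /= memvf].
have Udecr k : (U k.+1 <= U k)%VS.
  apply/lie_prodv_subP => x y _ yU; have [_] := Uideal k; exact.
pose P n := `[< exists k, \dim (U k) = n >].
have P0 : exists n, P n.
  by exists (\dim (U 0%N)); apply/asboolP; exists 0%N.
case: (ex_minnP P0) => _ /asboolP [k <-] dmin.
have Uk : U k.+1 = U k.
  apply/eqP; rewrite eqEdim Udecr dmin //.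
  by apply/asboolP; exists k.+1.
exists [set u | u \in U k]; split=> //.
  move=> W sW DW u /=; rewrite -Uk; have [V VE] := subspace_vspace sW.
  move=> uD; apply/VE; move: u uD; apply/subvP/lie_prodv_subP => x y xU yU.
  exact/VE/DW.
move=> U0; apply: nsol; exists k; apply/eqP; rewrite -subv0.
by apply/subvP => u /U0 ->; apply: mem0v.
Qed.

Lemma exists_max_ideal (D : set L) :
  ~ (D `<=` [set 0]) ->
  exists R : set L, [/\ ideal R, ~ (D `<=` R)
    & forall J, ideal J -> R `<=` J -> ~ (D `<=` J) -> J `<=` R].
Proof.
move=> D0; have [R [[iR nR] Rmax]] : exists R : set L,
    (ideal R /\ ~ (D `<=` R)) /\
    forall J, (ideal J /\ ~ (D `<=` J)) -> R `<=` J -> J `<=` R.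
  apply: exists_max_subspace => [W [[]]//|]; exists [set 0]; split=> //.
  by split=> [|x _ ->]; [exact: subspace_set0|exact: lie0r].
by exists R; split=> // J iJ sRJ nDJ; apply: Rmax.
Qed.

End NonsolvablePart.

(** * Nonvanishing *)

(** The elements acting as zero on [L / R] form an ideal that contains [R] and
    cannot contain [D = [D, D]], so it is [R], and any [a] in [D] outside [R]
    acts as a nonzero operator.  If [a] is not nilpotent on [L / R], let [c] be
    an eigenvector of it over [K], with eigenvalue [z].  Being a multiple of
    [[a, c]], it is the image of an element [x] of [K D], and [X] below is the
    action of [x]. *)
Lemma h1_not_vanishing (F : fieldType) (p : nat) (L : finDimLieAlgType F)
    (D R : set L) :
  p \in [pchar F] -> ideal D -> perfect D -> ideal R -> ~ (D `<=` R) ->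
  (forall J, ideal J -> R `<=` J -> ~ (D `<=` J) -> J `<=` R) ->
  ~ h1_vanishes D R.
Proof.
move=> pF iD pD iR nDR Rmax van.
have [|n [rep [q [s [rep_lin rep_lie qlie qker qs]]]]] :=
  adjoint_quotient_rep iR; first by move=> sLR; apply: nDR => d _; apply: sLR.
have [sR Rlie] := iR; have [sD Dlie] := iD.
have repR x : R x -> rep x = 0.
  move=> Rx; apply/row_matrixP => i; rewrite rowE row0 -(qs (delta_mx 0 i)) -qlie.
  by apply/qker; rewrite lieC; apply: subspaceN => //; apply: Rlie.
have sep := rep_power_separating rep_lin rep_lie pF iD pD van repR.
have [a [Da nRa]] : exists a, D a /\ ~ R a.
  apply: contrapT => no; apply: nDR => d Dd; apply: contrapT => nRd.
  by apply: no; exists d.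
have rep_a : rep a <> 0.
  move=> a0; pose Z := [set x | rep x = 0].
  apply/nRa/(Rmax Z); last by [].
  - split=> [|x d Zd]; last first.
      by move: Zd; rewrite /Z /= rep_lie => ->; rewrite mul0mx mulmx0 subr0.
    split=> [|b x y Zx Zy] /=; first by apply: repR; case: sR.
    by move: Zx Zy; rewrite /Z /= rep_lin => -> ->; rewrite scaler0 addr0.
  - exact: repR.
  - move=> sDZ; apply: nDR; apply: pD => // d e Dd De.
    by apply/qker; rewrite qlie (sDZ d Dd : rep d = 0) mulmx0.
have [[k Ak]|[K [iota [z [c [z0 c0 cA]]]]]] := nilpotent_or_eigenvector (rep a).
  by apply: rep_a; apply: kernel_square_nilpotent pF sep _ Ak; exists a.
pose e j := s (delta_mx 0 j : 'rV_n.+1); pose d j := lie a (e j).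
have Dd j : D (d j).
  by rewrite /d lieC; apply: subspaceN => //; apply: Dlie.
have qd j : q (d j) = row j (rep a) by rewrite qlie qs -rowE.
(* [x] is the sum of the [b j *: d j], that is, [z^-1] times the bracket of [a]
   with a representative of [c]. *)
pose b j := z^-1 * c 0 j.
pose X := \sum_j b j *: map_mx iota (rep (d j)).
have cE : c = \sum_j b j *: map_mx iota (q (d j)).
  rewrite -[LHS]scale1r -(mulVf z0) -scalerA -cA mulmx_sum_row scaler_sumr.
  by apply: eq_bigr => j _; rewrite scalerA qd map_row.
have cX : c *m X = 0.
  rewrite cE mulmx_suml -[RHS](@sum_alternating _ _ (fun k j =>
    (b k * b j) *: map_mx iota (q (lie (d j) (d k))))) => [|k|k j].
  - apply: eq_bigr => k _; rewrite mulmx_sumr; apply: eq_bigr => j _.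
    by rewrite -scalemxAl -scalemxAr scalerA -map_mxM qlie.
  - by rewrite liexx linear0 map_mx0 scaler0.
  - by rewrite lieC linearN map_mxN scalerN mulrC.
have aX : map_mx iota (q a) *m X = - (z *: c).
  rewrite -cA [in RHS]cE mulmx_suml -sumrN mulmx_sumr; apply: eq_bigr => j _.
  rewrite -scalemxAr -scalemxAl -scalerN -!map_mxM -map_mxN.
  by rewrite -!qlie (lieC (d j)) linearN.
have Ad j : (rep @` D) (rep (d j)) by exists (d j).
have : map_mx iota (q a) *m X = 0.
  apply: (kernel_square pF sep Ad); rewrite -/X aX mulNmx -scalemxAl cX.
  by rewrite scaler0 oppr0.
move=> /eqP; rewrite aX.
by rewrite oppr_eq0 scaler_eq0 (negPf z0) (negPf c0).
Qed.

(** * Cohomology of the quotient by the annihilator *)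

Section Cohomology.
Variables (F : fieldType) (L : lieAlgType F) (M : lmodType F).
Variable rho : lie_action L M.

(** A cocycle of [L] that vanishes on the annihilator factors through the
    quotient algebra, and the coboundaries there are the maps
    [x |-> x . s] for a fixed [s], a 0-cochain being determined by its value
    at the empty family. *)
Lemma ann_quot_h1_neq0 (R : set L) (f : L -> M) :
  (forall x, R x <-> x \in ann_pred rho) -> cocycle1 R rho f ->
  ~ (exists s, forall x, f x = rho x s) ->
  exists h : ce_H (ann_quot_action rho) 1%N, h != 0.
Proof.
move=> RE [flin fR flie] nB; apply/ce_H_neq0P.
pose Q := lie_quot (lie_ann rho).
pose fq (y : Q) := f (repr y).
have fqE x : fq (\pi_Q x) = f x.
  rewrite /fq; set x' := repr _.
  have /fR : R (x' - x) by apply/RE; rewrite (lie_quot_eq (lie_ann rho)) reprK.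
  have := flin 1 (x' - x) x; rewrite !scale1r subrK => -> ->.
  exact: add0r.
have fqlin : linear fq.
  move=> a; elim/lie_quotW => x; elim/lie_quotW => y.
  by rewrite -pi_lie_quotP !fqE flin.
exists (fun x => fq (x ord0)); split; first split.
- split=> [x i a y z|x i j]; last first.
    by rewrite (ord1 i) (ord1 j) eqxx.
  rewrite !ffunE !ord1 eqxx; exact: fqlin.
- apply/funext => x; rewrite /ce_d.
  rewrite !big_ord_recl !big_ord0 !big_mkcond !big_ord_recl !big_ord0 /=.
  rewrite /omit1 /omit2 !ffunE /= !addr0 !add0r expr0 !expr1 scale1r !scaleN1r.
  rewrite (_ : lift (lift ord0 ord0) ord0 = ord0); last exact: val_inj.
  elim/lie_quotW: (x ord0) => u; elim/lie_quotW: (x (lift ord0 ord0)) => v.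
  rewrite [lie _ _](pi_lie_quot_bracket (lie_ann rho)) !pi_ann_quot_act !fqE.
  rewrite big_pred0 => [|j]; first by rewrite addr0 flie; apply: subrr.
  by apply/negbTE; rewrite -leqNgt -ltnS ltn_ord.
- move=> [g _ gE]; apply: nB; exists (g [ffun=> 0]) => x.
  have := congr1 (fun k : ce_fun _ M 1 => k [ffun=> \pi_Q x]) gE.
  rewrite ffunE fqE => ->; rewrite /ce_d !big_ord_recl !big_ord0 !addr0.
  rewrite big_pred0 => [|j]; last by rewrite (ord1 j).
  rewrite addr0 expr0 scale1r /=.
  rewrite ffunE pi_ann_quot_act; congr (rho x (g _)).
  by apply/ffunP => - [].
Qed.

End Cohomology.

Theorem theorem4p2 (F : fieldType) (p : nat) (pcharFp : p \in [pchar F])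
    (L : finDimLieAlgType F) :
  ~ lie_solvable L ->
  exists (S : lmodType F) (rho : lie_action L S),
    lie_irreducible rho /\
    exists h : ce_H (ann_quot_action rho) 1%N, h != 0.
Proof.
move=> /exists_perfect_ideal [D [iD pD D0]].
have [R [iR nDR Rmax]] := exists_max_ideal D0.
apply: contrapT => none; apply: (h1_not_vanishing pcharFp iD pD iR nDR Rmax).
move=> S rho irr kR nkD f fZ; apply: contrapT => nB; apply: none.
exists S, rho; split=> //; apply: ann_quot_h1_neq0 fZ nB => x.
split=> [Rx|]; first by apply/ann_predP => u; apply: kR.
pose Ann := [set x | x \in ann_pred rho].
apply: (Rmax Ann) => [|y Ry|sDA].
- split; last by move=> y d; apply: ann_ideal.
  by have [A0 AP] := ann_submod_closed rho; split=> // a u v uA vA; apply: AP.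
- by apply/ann_predP => u; apply: kR.
- by apply: nkD => d u /sDA /ann_predP.
Qed.
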